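(* Let $k$ be a field, $n\ge1$, $Q=\widetilde{A_n}$, and $\delta=(1,\dots,1)\in\mathbb{N}^{Q_0}$. Then the canonical map $$\mathrm{ev}_Z:Z(\Lambda^1(Q))\to k[\mathcal{M}_{1,0}(Q,\delta)]$$ from the center of the multiplicative preprojective algebra to the ring of functions on the multiplicative quiver variety is an isomorphism.
   Context: $\widetilde{A_n}$ is the quiver which is a cycle with $n+1$ vertices and $n+1$ arrows. For a finite quiver $Q$, let $\overline{Q}$ be its double (reverse arrow $a^*$ added for each $a\in Q_1$, $(a^* )^*=a$), $\epsilon(a)=1$ for $a\in Q_1$, $-1$ otherwise; $L_Q=k\overline{Q}[(1+aa^* )^{-1}]_{a\in\overline{Q}_1}$; for a fixed total order on $\overline{Q}_1$, $\rho=\prod_{a\in\overline{Q}_1}(1+aa^* )^{\epsilon(a)}$. Then $\Lambda^1(Q)=L_Q/(\rho-1)$ (parameter $q=(1,\dots,1)$). Let $V=k^{Q_0}=\bigoplus_{i\in Q_0}k$ and $\mathrm{Rep}_\delta(\Lambda^1(Q))=\mathrm{Hom}_{kQ_0\text{-alg}}(\Lambda^1(Q),\mathrm{End}_k(V))$, the affine scheme of representations of dimension vector $\delta$, with its action of $GL_\delta=\prod_{i\in Q_0}GL_1$ by change of basis. The multiplicative quiver variety (parameter $q=1$, stability $\theta=0$) is $\mathcal{M}_{1,0}(Q,\delta)=\mathrm{Rep}_\delta(\Lambda^1(Q))/\!/GL_\delta$, so $k[\mathcal{M}_{1,0}(Q,\delta)]=k[\mathrm{Rep}_\delta(\Lambda^1(Q))]^{GL_\delta}$.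 Evaluation $\mathrm{ev}:\Lambda^1(Q)\to k[\mathrm{Rep}_\delta(\Lambda^1(Q))]\otimes\mathrm{End}_k(V)$ is $\mathrm{ev}(a)(\rho)=\rho(a)$. For a central element $z$, $\mathrm{ev}(z)$ lies in $k[\mathrm{Rep}_\delta(\Lambda^1(Q))]\cdot\mathrm{Id}_V$ and its coefficient is $GL_\delta$-invariant; $\mathrm{ev}_Z(z)$ is this coefficient, i.e. $\mathrm{ev}_Z(z)(\rho)$ is the scalar by which $z$ acts in the representation $\rho$. *)

(* Defs.v *)
From HB Require Import structures.
From mathcomp Require Import all_boot all_order all_algebra.
From mathcomp Require Import boolp.
From mathcomp Require Import finmap monalg.

Set Implicit Arguments.
Unset Strict Implicit.
Unset Printing Implicit Defensive.

Import GRing.Theory.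
Local Open Scope ring_scope.

Section TwoSidedIdeal.
Variables (k : fieldType) (A : algType k) (S : A -> Prop).

(* The two-sided ideal generated by S. *)
Inductive ideal_gen : A -> Prop :=
| ideal_gen_mem a x b : S x -> ideal_gen (a * x * b)
| ideal_gen0 : ideal_gen 0
| ideal_genD x y : ideal_gen x -> ideal_gen y -> ideal_gen (x + y).

Lemma ideal_gen_sub x : S x -> ideal_gen x.
Proof. by move=> Sx; rewrite -[x]mul1r -[1 * x]mulr1; apply: ideal_gen_mem. Qed.

Lemma ideal_genMl a x : ideal_gen x -> ideal_gen (a * x).
Proof.
elim=> [b y c Sy||y z _ Iy _ Iz]; last by rewrite mulrDr; apply: ideal_genD.
  by rewrite !mulrA; apply: ideal_gen_mem.
by rewrite mulr0; apply: ideal_gen0.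
Qed.

Lemma ideal_genMr a x : ideal_gen x -> ideal_gen (x * a).
Proof.
elim=> [b y c Sy||y z _ Iy _ Iz]; last by rewrite mulrDl; apply: ideal_genD.
  by rewrite -!mulrA [b * _]mulrA; apply: ideal_gen_mem.
by rewrite mul0r; apply: ideal_gen0.
Qed.

Lemma ideal_genZ c x : ideal_gen x -> ideal_gen (c *: x).
Proof. by move=> Ix; rewrite -[x]mul1r scalerAl; apply: ideal_genMl. Qed.

Lemma ideal_genN x : ideal_gen x -> ideal_gen (- x).
Proof. by rewrite -scaleN1r; apply: ideal_genZ. Qed.

Lemma ideal_genB x y : ideal_gen x -> ideal_gen y -> ideal_gen (x - y).
Proof. by move=> Ix Iy; apply: ideal_genD => //; apply: ideal_genN. Qed.

Definition ideal_equiv : rel A := fun x y => `[< ideal_gen (x - y) >].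

Lemma ideal_equiv_equiv : equiv_class_of ideal_equiv.
Proof.
split=> [x|x y|y x z].
- by apply/asboolP; rewrite subrr; apply: ideal_gen0.
- by apply/asboolP/asboolP => /ideal_genN; rewrite opprB.
- move=> /asboolP Ixy /asboolP Iyz; apply/asboolP.
  by rewrite -(subrK y x) -addrA; apply: ideal_genD.
Qed.

Canonical ideal_equivRel := EquivRelPack ideal_equiv_equiv.

Local Open Scope quotient_scope.

(* The hypothesis that the ideal is proper is part of the type because the
   algebras of the library are nonzero rings. *)
Definition quot_alg of ~ ideal_gen 1 := {eq_quot ideal_equivRel}.

Section Structure.
Variable prS : ~ ideal_gen 1.
Local Notation Q := (quot_alg prS).

HB.instance Definition _ := Choice.on Q.
HB.instance Definition _ := EqQuotient.on Q.

Definition quot_pi (x : A) : Q := \pi_Q x.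

Lemma quot_pi_eq x y : quot_pi x = quot_pi y <-> ideal_gen (x - y).
Proof.
split=> [/eqmodP/asboolP//|Ixy]; apply/eqmodP; exact/asboolP.
Qed.

Lemma quot_piP (u : Q) : exists x, quot_pi x = u.
Proof. by exists (repr u); rewrite /quot_pi reprK. Qed.

Lemma quot_pi_repr x : ideal_gen (repr (quot_pi x) - x).
Proof. by apply/quot_pi_eq; rewrite /quot_pi reprK. Qed.

Definition quot_zero : Q := quot_pi 0.
Definition quot_opp (u : Q) : Q := quot_pi (- repr u).
Definition quot_add (u v : Q) : Q := quot_pi (repr u + repr v).
Definition quot_one : Q := quot_pi 1.
Definition quot_mul (u v : Q) : Q := quot_pi (repr u * repr v).
Definition quot_scale (c : k) (u : Q) : Q := quot_pi (c *: repr u).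

Lemma quot_oppE x : quot_opp (quot_pi x) = quot_pi (- x).
Proof.
by apply/quot_pi_eq; rewrite -opprD; apply: ideal_genN; apply: quot_pi_repr.
Qed.

Lemma quot_addE x y : quot_add (quot_pi x) (quot_pi y) = quot_pi (x + y).
Proof.
by apply/quot_pi_eq; rewrite opprD addrACA; apply: ideal_genD;
  apply: quot_pi_repr.
Qed.

Lemma quot_mulE x y : quot_mul (quot_pi x) (quot_pi y) = quot_pi (x * y).
Proof.
apply/quot_pi_eq; set x' := repr _; set y' := repr _.
have -> : x' * y' - x * y = (x' - x) * y' + x * (y' - y).
  by rewrite mulrBl mulrBr addrA subrK.
apply: ideal_genD; [apply: ideal_genMr|apply: ideal_genMl]; exact: quot_pi_repr.
Qed.

Lemma quot_scaleE c x : quot_scale c (quot_pi x) = quot_pi (c *: x).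
Proof.
by apply/quot_pi_eq; rewrite -scalerBr; apply: ideal_genZ; apply: quot_pi_repr.
Qed.

Local Ltac lift u := let x := fresh u in case: (quot_piP u) => x <-.
Local Notation quotE := (quot_oppE, quot_addE, quot_mulE, quot_scaleE).

Lemma quot_addA : associative quot_add.
Proof. by move=> u v w; lift u; lift v; lift w; rewrite !quotE addrA. Qed.
Lemma quot_addC : commutative quot_add.
Proof. by move=> u v; lift u; lift v; rewrite !quotE addrC. Qed.
Lemma quot_add0 : left_id quot_zero quot_add.
Proof. by move=> u; lift u; rewrite !quotE add0r. Qed.
Lemma quot_addN : left_inverse quot_zero quot_opp quot_add.
Proof. by move=> u; lift u; rewrite !quotE addNr. Qed.

HB.instance Definition _ := GRing.isZmodule.Build Q
  quot_addA quot_addC quot_add0 quot_addN.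

Lemma quot_mulA : associative quot_mul.
Proof. by move=> u v w; lift u; lift v; lift w; rewrite !quotE mulrA. Qed.
Lemma quot_mul1 : left_id quot_one quot_mul.
Proof. by move=> u; lift u; rewrite !quotE mul1r. Qed.
Lemma quot_mulr1 : right_id quot_one quot_mul.
Proof. by move=> u; lift u; rewrite !quotE mulr1. Qed.
Lemma quot_mulDl : left_distributive quot_mul quot_add.
Proof. by move=> u v w; lift u; lift v; lift w; rewrite !quotE mulrDl. Qed.
Lemma quot_mulDr : right_distributive quot_mul quot_add.
Proof. by move=> u v w; lift u; lift v; lift w; rewrite !quotE mulrDr. Qed.
Lemma quot_one_neq0 : quot_one != quot_zero.
Proof. by apply/eqP=> /quot_pi_eq; rewrite subr0. Qed.

HB.instance Definition _ := GRing.Zmodule_isNzRing.Build Q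
  quot_mulA quot_mul1 quot_mulr1 quot_mulDl quot_mulDr quot_one_neq0.

Lemma quot_scaleA c d u : quot_scale c (quot_scale d u) = quot_scale (c * d) u.
Proof. by lift u; rewrite !quotE scalerA. Qed.
Lemma quot_scale1 : left_id 1 quot_scale.
Proof. by move=> u; lift u; rewrite !quotE scale1r. Qed.
Lemma quot_scaleDr : right_distributive quot_scale quot_add.
Proof. by move=> c u v; lift u; lift v; rewrite !quotE scalerDr. Qed.
Lemma quot_scaleDl u : {morph quot_scale^~ u : c d / c + d >-> quot_add c d}.
Proof. by move=> c d; lift u; rewrite !quotE scalerDl. Qed.

HB.instance Definition _ := GRing.Zmodule_isLmodule.Build k Q
  quot_scaleA quot_scale1 quot_scaleDr quot_scaleDl.

Lemma quot_scaleAl c (u v : Q) : c *: (u * v) = (c *: u) * v.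
Proof.
by lift u; lift v; rewrite /GRing.scale /GRing.mul /= !quotE scalerAl.
Qed.
Lemma quot_scaleAr c (u v : Q) : c *: (u * v) = u * (c *: v).
Proof.
by lift u; lift v; rewrite /GRing.scale /GRing.mul /= !quotE scalerAr.
Qed.

HB.instance Definition _ := GRing.Lmodule_isLalgebra.Build k Q quot_scaleAl.
HB.instance Definition _ := GRing.Lalgebra_isAlgebra.Build k Q quot_scaleAr.

Lemma quot_pi_is_zmod_morphism : zmod_morphism quot_pi.
Proof.
move=> x y; rewrite -quot_addE -quot_oppE; reflexivity.
Qed.
Lemma quot_pi_is_monoid_morphism : monoid_morphism quot_pi.
Proof. by split=> // x y; rewrite -quot_mulE. Qed.
Lemma quot_pi_is_scalable : scalable quot_pi.
Proof. by move=> c x; rewrite -quot_scaleE. Qed.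

HB.instance Definition _ :=
  GRing.isZmodMorphism.Build A Q quot_pi quot_pi_is_zmod_morphism.
HB.instance Definition _ :=
  GRing.isMonoidMorphism.Build A Q quot_pi quot_pi_is_monoid_morphism.
HB.instance Definition _ :=
  GRing.isScalable.Build k A Q *:%R quot_pi quot_pi_is_scalable.

Lemma quot_pi_ker x : quot_pi x = 0 <-> ideal_gen x.
Proof. by rewrite -[in X in _ <-> X](subr0 x) -quot_pi_eq rmorph0. Qed.

End Structure.

Lemma ideal_gen_ker (B : pzRingType) (f : {rmorphism A -> B}) :
  (forall x, S x -> f x = 0) -> forall x, ideal_gen x -> f x = 0.
Proof.
move=> Sf x; elim=> [a y b Sy||y z _ fy _ fz]; last by rewrite rmorphD fy fz addr0.
  by rewrite !rmorphM (Sf y Sy) mulr0 mul0r.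
by rewrite rmorph0.
Qed.

Lemma ideal_gen_proper (B : nzRingType) (f : {rmorphism A -> B}) :
  (forall x, S x -> f x = 0) -> ~ ideal_gen 1.
Proof.
by move=> Sf /(ideal_gen_ker Sf)/eqP; rewrite rmorph1 oner_eq0.
Qed.

Section Lift.
Variables (prS : ~ ideal_gen 1) (B : pzRingType) (f : {rmorphism A -> B}).
Hypothesis Sf : forall x, S x -> f x = 0.

Lemma quot_repr_ker x : f (repr (quot_pi prS x)) = f x.
Proof.
apply/eqP; rewrite -subr_eq0 -rmorphB; apply/eqP.
exact: (ideal_gen_ker Sf (quot_pi_repr prS x)).
Qed.

End Lift.

End TwoSidedIdeal.

Section QuotLift.
Variables (k : fieldType) (A : algType k) (S : A -> Prop).
Variables (prS : ~ ideal_gen S 1) (B : algType k).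
Variables (f : {lrmorphism A -> B}) (Sf : forall x, S x -> f x = 0).

Definition quot_lift of (forall x, S x -> f x = 0) : quot_alg prS -> B :=
  fun u => f (repr u).

Lemma quot_liftE x : quot_lift Sf (quot_pi prS x) = f x.
Proof. exact: quot_repr_ker. Qed.

Fact quot_lift_is_zmod_morphism : zmod_morphism (quot_lift Sf).
Proof.
move=> u v; have [[x <-] [y <-]] := (quot_piP u, quot_piP v).
by rewrite -rmorphB !quot_liftE rmorphB.
Qed.
Fact quot_lift_is_monoid_morphism : monoid_morphism (quot_lift Sf).
Proof.
split=> [|u v]; first by rewrite -(rmorph1 (quot_pi prS)) quot_liftE rmorph1.
have [[x <-] [y <-]] := (quot_piP u, quot_piP v).
by rewrite -rmorphM !quot_liftE rmorphM.
Qed.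
Fact quot_lift_is_scalable : scalable (quot_lift Sf).
Proof.
move=> c u; have [x <-] := quot_piP u.
by rewrite -linearZ !quot_liftE linearZ.
Qed.
HB.instance Definition _ := GRing.isZmodMorphism.Build (quot_alg prS) B
  (quot_lift Sf) quot_lift_is_zmod_morphism.
HB.instance Definition _ := GRing.isMonoidMorphism.Build (quot_alg prS) B
  (quot_lift Sf) quot_lift_is_monoid_morphism.
HB.instance Definition _ := GRing.isScalable.Build k (quot_alg prS) B *:%R
  (quot_lift Sf) quot_lift_is_scalable.

End QuotLift.

Section MonoidAlgebraEval.
Variables (k : fieldType) (K : monomType) (B : algType k).
Variable h : {mmorphism K -> B}.

Definition malg_eval : {malg k[K]} -> B := mmap (GRing.in_alg B) h.

Fact malg_eval_is_zmod_morphism : zmod_morphism malg_eval.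
Proof. exact: raddfB. Qed.
Fact malg_eval_is_monoid_morphism : monoid_morphism malg_eval.
Proof.
have [|eM e1] := @commr_mmap_is_multiplicative K k B (GRing.in_alg B) h.
  by move=> g m m'; rewrite /GRing.comm /= mulr_algl mulr_algr.
by split.
Qed.
Fact malg_eval_is_scalable : scalable malg_eval.
Proof. by move=> c g; rewrite /malg_eval mmapZ /= mulr_algl. Qed.
HB.instance Definition _ := GRing.isZmodMorphism.Build {malg k[K]} B malg_eval
  malg_eval_is_zmod_morphism.
HB.instance Definition _ := GRing.isMonoidMorphism.Build {malg k[K]} B malg_eval
  malg_eval_is_monoid_morphism.
HB.instance Definition _ := GRing.isScalable.Build k {malg k[K]} B *:%R malg_eval
  malg_eval_is_scalable.

Lemma malg_evalU m : malg_eval << m >> = h m.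
Proof. by rewrite /malg_eval mmapU /= scale1r mul1r. Qed.

End MonoidAlgebraEval.

Lemma malg_scaleU (k : fieldType) (K : choiceType) c (p : K) :
  << c *g p >> = c *: << p >> :> {malg k[K]}.
Proof. by apply/malgP => q; rewrite mcoeffZ !mcoeffU mulr_natr. Qed.

Lemma malg_scaleAr (k : fieldType) (K : monomType) c (x y : {malg k[K]}) :
  c *: (x * y) = x * (c *: y).
Proof.
have mulC : c%:MP * x = x * c%:MP.
  rewrite [LHS]malgM_def [RHS]malgM_def fgmulUg fgmulgU.
  by apply: eq_bigr => i _; rewrite mul1m mulm1 mulrC.
by rewrite -(mul_malgC c y) mulrA -mulC -mulrA mul_malgC.
Qed.

(* Locking keeps conversion from unfolding finitely supported functions. *)
Fact gen_key : unit. Proof. exact: tt. Qed.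

Section FreeAlgebras.
Variables (k : fieldType) (X : choiceType).

Definition free_alg := {malg k[{fmonom X}]}.
HB.instance Definition _ := GRing.Lalgebra.on free_alg.

Fact free_alg_scaleAr c (x y : free_alg) : c *: (x * y) = x * (c *: y).
Proof.
exact: malg_scaleAr.
Qed.
HB.instance Definition _ := GRing.Lalgebra_isAlgebra.Build k free_alg
  free_alg_scaleAr.

Definition free_gen : X -> free_alg := locked_with gen_key (fun x => << fmu x >>).
Lemma free_genE x : free_gen x = << fmu x >>.
Proof. by rewrite /free_gen unlock. Qed.

Definition poly_alg := {malg k[{cmonom X}]}.
HB.instance Definition _ := GRing.ComAlgebra.on poly_alg.

Definition poly_gen : X -> poly_alg := locked_with gen_key (fun x => << ucm x >>).
Lemma poly_genE x : poly_gen x = << ucm x >>.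
Proof. by rewrite /poly_gen unlock. Qed.

Section FreeEval.
Variables (B : algType k) (g : X -> B).

Definition fmonom_eval (m : {fmonom X}) : B := \prod_(x <- (m : seq X)) g x.
Fact fmonom_eval_mmorphism : mmorphism fmonom_eval.
Proof.
split=> [x y|]; rewrite /fmonom_eval ?fmM ?big_cat //.
by rewrite fm1 big_nil.
Qed.
HB.instance Definition _ :=
  monalg.isMultiplicative.Build {fmonom X} B fmonom_eval fmonom_eval_mmorphism.

Definition free_eval : free_alg -> B := malg_eval fmonom_eval.
HB.instance Definition _ := GRing.LRMorphism.on free_eval.

Lemma free_eval_gen x : free_eval (free_gen x) = g x.
Proof. rewrite free_genE /free_eval malg_evalU /= fmuE; exact: big_seq1. Qed.
End FreeEval.

Section PolyEval.
Variables (B : comAlgType k) (g : X -> B).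

Definition cmonom_eval (m : {cmonom X}) : B :=
  \prod_(x <- finsupp m) g x ^+ m x.
Lemma cmonom_evalEw (m : {cmonom X}) (d : {fset X}) : (finsupp m `<=` d)%fset ->
  cmonom_eval m = \prod_(x <- d) g x ^+ m x.
Proof.
move=> le; apply: big_fset_incl => // x _.
by rewrite -cmE_eq0 => /eqP->; rewrite expr0.
Qed.
Fact cmonom_eval_mmorphism : mmorphism cmonom_eval.
Proof.
split=> [x y|]; last by rewrite /cmonom_eval mdom1 big_seq_fset0.
rewrite [LHS](@cmonom_evalEw _ (finsupp x `|` finsupp y)%fset) ?mdomD //.
rewrite (@cmonom_evalEw x _ (fsubsetUl _ (finsupp y))).
rewrite (@cmonom_evalEw y _ (fsubsetUr (finsupp x) _)).
by rewrite -big_split; apply: eq_bigr => i _; rewrite /= cmM exprD.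
Qed.
HB.instance Definition _ :=
  monalg.isMultiplicative.Build {cmonom X} B cmonom_eval cmonom_eval_mmorphism.

Definition poly_eval : poly_alg -> B := malg_eval cmonom_eval.
HB.instance Definition _ := GRing.LRMorphism.on poly_eval.

Lemma poly_eval_gen x : poly_eval (poly_gen x) = g x.
Proof.
by rewrite poly_genE /poly_eval malg_evalU [LHS]/= [LHS]/cmonom_eval mdomU big_seq_fset1 cmUU expr1.
Qed.
End PolyEval.
End FreeAlgebras.


Lemma cmonom_ind (X : choiceType) (T : {cmonom X} -> Prop) : T mone ->
  (forall x m, T m -> T (mmul (ucm x) m)) -> forall m, T m.
Proof.
move=> T1 TM m; have [d] := ubnP (mdeg m); elim: d m => // d IHd m.
have [z|[x xm]] := fset_0Vmem (finsupp m).
  have -> : m = mone; last by [].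
  by apply/eqP; rewrite -mdeg_eq0 mdegE z big_seq_fset0.
have [m' ->] : exists m', m = mmul (ucm x) m'; last first.
  by rewrite mdegM mdegU ltnS => /IHd; apply: TM.
exists (divcm m (ucm x)).
apply/eqP/cmP => y; rewrite cmM divcmE ucmE subnKC //.
by case: eqP => // <-; rewrite lt0n cmE_neq0.
Qed.

Lemma poly_alg_ext (k : fieldType) (X : choiceType) (B : comAlgType k)
    (f g : {lrmorphism poly_alg k X -> B}) :
  (forall x, f (poly_gen k x) = g (poly_gen k x)) -> f =1 g.
Proof.
move=> fg p; rewrite [p]monalgE !raddf_sum; apply: eq_bigr => m _ /=.
rewrite malg_scaleU !linearZ; congr (_ *: _).
elim/cmonom_ind: m => [|x m IHm]; first exact: etrans (rmorph1 f) (esym (rmorph1 g)).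
have -> : << mmul (ucm x) m >> = poly_gen k x * << m >> :> poly_alg k X.
  by rewrite poly_genE [RHS]malgM_def fgmulUU mul1r.
by rewrite [LHS]rmorphM [RHS]rmorphM /= fg IHm.
Qed.

(* A finite quiver; vertices are numbered so that matrices can be indexed by
   them, and there is at least one so that the path algebra is nonzero. *)
Record quiver := Quiver {
  nvertex : nat;
  arrow : finType;
  source : arrow -> 'I_nvertex.+1;
  target : arrow -> 'I_nvertex.+1 }.

Notation vertex Q := 'I_(nvertex Q).+1.

Definition double_quiver (Q : quiver) : quiver :=
  @Quiver (nvertex Q) (arrow Q + arrow Q)%type
    (fun a => match a with inl b => source b | inr b => target b end)
    (fun a => match a with inl b => target b | inr b => source b end).

Definition star (Q : quiver) (a : arrow (double_quiver Q)) : arrow (double_quiver Q) :=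
  match a with inl b => inr b | inr b => inl b end.

Section PathAlgebra.
Variables (k : fieldType) (Q : quiver).
Implicit Types (i j : vertex Q) (s t : seq (arrow Q)).

(* Paths compose like functions: [(i, [:: a1; ...; am])] stands for the path
   a1 a2 ... am, which first follows am and ends at i = target a1. *)
Fixpoint is_path i s : bool :=
  if s is a :: s' then (target a == i) && is_path (source a) s' else true.

Definition qpath := {p : vertex Q * seq (arrow Q) | is_path p.1 p.2}.

Definition path_target (p : qpath) : vertex Q := (val p).1.
Definition path_source (p : qpath) : vertex Q :=
  last (val p).1 (map (@source Q) (val p).2).

Lemma is_path_cat i s t : is_path i (s ++ t) =
  is_path i s && is_path (last i (map (@source Q) s)) t.
Proof. by elim: s i => //= a s IHs i; rewrite IHs andbA. Qed.

Definition trivial_path i : qpath := Sub (i, [::]) isT.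

Fact arrow_path_subproof (a : arrow Q) : is_path (target a) [:: a].
Proof. by rewrite /= eqxx. Qed.
Definition arrow_path (a : arrow Q) : qpath :=
  Sub (target a, [:: a]) (arrow_path_subproof a).

Definition path_comp (p q : qpath) : option qpath :=
  if path_source p == path_target q
  then insub ((val p).1, (val p).2 ++ (val q).2) : option qpath else None.

Lemma path_compE (p q r : qpath) : path_comp p q = Some r <->
  path_source p = path_target q /\ val r = ((val p).1, (val p).2 ++ (val q).2).
Proof.
rewrite /path_comp; split.
  case: eqP => // e; case: insubP => // u _ eu [<-]; split=> //; exact: eu.
case=> e er; rewrite e eqxx; case: insubP => [u _ eu|].
  by congr Some; apply: val_inj; rewrite er; exact: eu.
by rewrite -er (valP r).
Qed.

Lemma path_comp_some (p q : qpath) :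
  path_source p = path_target q -> exists r, path_comp p q = Some r.
Proof.
move=> e; have wf : is_path (val p).1 ((val p).2 ++ (val q).2).
  by rewrite is_path_cat (valP p) /= -/(path_source p) e (valP q).
by exists (Sub ((val p).1, (val p).2 ++ (val q).2) wf); apply/path_compE.
Qed.

Lemma path_comp_none (p q : qpath) :
  path_source p <> path_target q -> path_comp p q = None.
Proof. by rewrite /path_comp; case: eqP. Qed.

Lemma path_comp_source (p q r : qpath) : path_comp p q = Some r ->
  path_source r = path_source q.
Proof.
case/path_compE=> e er; rewrite /path_source er /= map_cat last_cat.
by rewrite -/(path_source p) e.
Qed.

Lemma path_comp_target (p q r : qpath) : path_comp p q = Some r ->
  path_target r = path_target p.
Proof. by case/path_compE=> _ er; rewrite /path_target er. Qed.

Lemma path_compA (p q r : qpath) :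
  obind (path_comp^~ r) (path_comp p q) = obind (path_comp p) (path_comp q r).
Proof.
have [epq|npq] := eqVneq (path_source p) (path_target q); last first.
  rewrite (path_comp_none (elimN eqP npq)) /=.
  case E: (path_comp q r) => [u|] //=; rewrite path_comp_none //.
  by rewrite (path_comp_target E); apply/eqP.
have [u Eu] := path_comp_some epq; rewrite Eu /=.
have [eqr|nqr] := eqVneq (path_source q) (path_target r); last first.
  rewrite (path_comp_none (elimN eqP nqr)) /= path_comp_none //.
  by rewrite (path_comp_source Eu); apply/eqP.
have [v Ev] := path_comp_some eqr; rewrite Ev /=.
have [|w Ew] := @path_comp_some u r; first by rewrite (path_comp_source Eu).
rewrite Ew; symmetry; apply/path_compE.
split; first by rewrite (path_comp_target Ev).
have [_ ->] := (path_compE _ _ _).1 Ew.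
have [_ ->] := (path_compE _ _ _).1 Eu.
by have [_ ->] := (path_compE _ _ _).1 Ev; rewrite /= catA.
Qed.

Lemma trivial_path_comp i (p : qpath) :
  path_comp (trivial_path i) p = if path_target p == i then Some p else None.
Proof.
case: eqP => [<-|ne]; last by apply: path_comp_none => e; apply: ne.
by apply/path_compE; split=> //=; rewrite /path_target -surjective_pairing.
Qed.

Lemma path_comp_trivial i (p : qpath) :
  path_comp p (trivial_path i) = if path_source p == i then Some p else None.
Proof.
case: eqP => [<-|ne]; last exact: path_comp_none.
by apply/path_compE; split=> //=; rewrite cats0 -surjective_pairing.
Qed.

(* The vector space with basis the set of paths. *)
Definition path_alg := {malg k[qpath]}.
HB.instance Definition _ := GRing.Lmodule.on path_alg.

Definition path_elt : qpath -> path_alg := locked_with gen_key (fun p => << p >>).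
Lemma path_eltE p : path_elt p = << p >>.
Proof. by rewrite /path_elt unlock. Qed.

Section LinearExtension.
Variables (V : lmodType k) (h : qpath -> V).

Definition lin_ext (f : path_alg) : V := \sum_(p <- msupp f) f@_p *: h p.

Lemma lin_extEw (d : {fset qpath}) (f : path_alg) :
  (msupp f `<=` d)%fset -> lin_ext f = \sum_(p <- d) f@_p *: h p.
Proof.
move=> le; apply: big_fset_incl => // p _ /mcoeff_outdom ->.
by rewrite scale0r.
Qed.

Fact lin_ext_is_linear : linear lin_ext.
Proof.
move=> c f g; pose d := (msupp (c *: f + g) `|` (msupp f `|` msupp g))%fset.
rewrite (@lin_extEw d (c *: f + g)) ?fsubsetUl //.
rewrite (@lin_extEw d f); last by rewrite fsubsetU // fsubsetUl orbT.
rewrite (@lin_extEw d g); last by rewrite fsubsetU // fsubsetUr orbT.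
rewrite scaler_sumr -big_split; apply: eq_bigr => p _ /=.
by rewrite mcoeffD mcoeffZ scalerDl scalerA.
Qed.
HB.instance Definition _ := GRing.isLinear.Build k path_alg V *:%R lin_ext
  lin_ext_is_linear.

Lemma lin_ext_elt p : lin_ext (path_elt p) = h p.
Proof.
rewrite path_eltE (lin_extEw msuppU_le) big_seq_fset1 mcoeffUU.
exact: scale1r.
Qed.
End LinearExtension.

Lemma path_alg_sum (f : path_alg) : f = \sum_(p <- msupp f) f@_p *: path_elt p.
Proof.
rewrite [LHS]monalgE; apply: eq_bigr => p _.
rewrite path_eltE; exact: malg_scaleU.
Qed.

Lemma path_alg_ext (V : lmodType k) (F G : path_alg -> V) : linear F -> linear G ->
  (forall p, F (path_elt p) = G (path_elt p)) -> F =1 G.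
Proof.
move=> lF lG FG f; pose F' := GRing.isLinear.Build k path_alg V *:%R F lF.
pose G' := GRing.isLinear.Build k path_alg V *:%R G lG.
pose F1 : {linear path_alg -> V} := HB.pack F F'.
pose G1 : {linear path_alg -> V} := HB.pack G G'.
have: F1 f = G1 f; last by [].
rewrite [f]path_alg_sum !linear_sum; apply: eq_bigr => p _.
by rewrite !linearZ; congr (_ *: _); apply: FG.
Qed.

Definition path_mulb (p q : qpath) : path_alg :=
  if path_comp p q is Some r then path_elt r else 0.

Definition path_mul : path_alg -> path_alg -> path_alg :=
  locked_with gen_key (fun f g =>
    \sum_(p <- msupp f) \sum_(q <- msupp g) (f@_p * g@_q) *: path_mulb p q).

Definition path_one : path_alg := \sum_(i : vertex Q) path_elt (trivial_path i).

Lemma path_mulE f g :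
  path_mul f g = lin_ext (fun p => lin_ext (path_mulb p) g) f.
Proof.
rewrite /path_mul unlock /lin_ext; apply: eq_bigr => p _.
by rewrite scaler_sumr; apply: eq_bigr => q _; rewrite scalerA.
Qed.

Lemma path_mulEr f g :
  path_mul f g = lin_ext (fun q => lin_ext (path_mulb^~ q) f) g.
Proof.
rewrite /path_mul unlock /lin_ext exchange_big; apply: eq_bigr => q _.
by rewrite scaler_sumr; apply: eq_bigr => p _; rewrite scalerA mulrC.
Qed.

Lemma path_mul_elt p q : path_mul (path_elt p) (path_elt q) = path_mulb p q.
Proof. by rewrite path_mulE !lin_ext_elt. Qed.

Fact path_mul_linearl g : linear (path_mul^~ g).
Proof. by move=> c f f'; rewrite !path_mulE linearP. Qed.
Fact path_mul_linearr f : linear (path_mul f).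
Proof. by move=> c g g'; rewrite !path_mulEr linearP. Qed.

Lemma path_mulDl : left_distributive path_mul +%R.
Proof. by move=> f f' g; rewrite !path_mulE linearD. Qed.
Lemma path_mulDr : right_distributive path_mul +%R.
Proof. by move=> f g g'; rewrite !path_mulEr linearD. Qed.
Lemma path_mulZl c f g : path_mul (c *: f) g = c *: path_mul f g.
Proof. by rewrite !path_mulE linearZ. Qed.
Lemma path_mulZr c f g : path_mul f (c *: g) = c *: path_mul f g.
Proof. by rewrite !path_mulEr linearZ. Qed.
Lemma path_mul_suml (I : Type) (r : seq I) (F : I -> path_alg) g :
  path_mul (\sum_(i <- r) F i) g = \sum_(i <- r) path_mul (F i) g.
Proof. by rewrite path_mulE linear_sum; apply: eq_bigr => i _; rewrite path_mulE. Qed.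
Lemma path_mul_sumr (I : Type) (r : seq I) (F : I -> path_alg) f :
  path_mul f (\sum_(i <- r) F i) = \sum_(i <- r) path_mul f (F i).
Proof. by rewrite path_mulEr linear_sum; apply: eq_bigr => i _; rewrite path_mulEr. Qed.

Lemma path_mul0l f : path_mul 0 f = 0.
Proof. by rewrite path_mulE linear0. Qed.
Lemma path_mul0r f : path_mul f 0 = 0.
Proof. by rewrite path_mulEr linear0. Qed.

Lemma path_mulb_mulA p q r :
  path_mul (path_elt p) (path_mulb q r) = path_mul (path_mulb p q) (path_elt r).
Proof.
have := path_compA p q r; rewrite /path_mulb.
case Epq: (path_comp p q) => [u|]; case Eqr: (path_comp q r) => [v|] /=.
- by move=> e; rewrite !path_mul_elt /path_mulb e.
- move=> e; rewrite path_mul_elt /path_mulb e.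
  exact: path_mul0r.
- by move=> e; rewrite path_mul_elt /path_mulb -e; exact: esym (path_mul0l _).
- by move=> _; exact: etrans (path_mul0r _) (esym (path_mul0l _)).
Qed.

Lemma path_mulA : associative path_mul.
Proof.
move=> f g h; move: f; apply: path_alg_ext => [|c f f'|p].
- exact: path_mul_linearl.
- exact: etrans (congr1 (path_mul^~ h) (path_mul_linearl g c f f'))
                (path_mul_linearl h _ _ _).
move: g; apply: path_alg_ext => [c g g'|c g g'|q].
- exact: etrans (congr1 (path_mul _) (path_mul_linearl h c g g'))
                (path_mul_linearr _ _ _ _).
- exact: etrans (congr1 (path_mul^~ h) (path_mul_linearr _ c g g'))
                (path_mul_linearl h _ _ _).
move: h; apply: path_alg_ext => [c h h'||r].
- exact: etrans (congr1 (path_mul _) (path_mul_linearr _ c h h'))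
                (path_mul_linearr _ _ _ _).
- exact: path_mul_linearr.
by rewrite !path_mul_elt path_mulb_mulA.
Qed.

Lemma path_mul1 : left_id path_one path_mul.
Proof.
apply: path_alg_ext => [||p] //; first exact: path_mul_linearr.
rewrite /path_one path_mul_suml (bigD1 (path_target p)) //=.
rewrite path_mul_elt /path_mulb trivial_path_comp eqxx big1 ?addr0 // => i ne.
by rewrite path_mul_elt /path_mulb trivial_path_comp eq_sym (negPf ne).
Qed.

Lemma path_mulr1 : right_id path_one path_mul.
Proof.
apply: path_alg_ext => [||p] //; first exact: path_mul_linearl.
rewrite /path_one path_mul_sumr (bigD1 (path_source p)) //=.
rewrite path_mul_elt /path_mulb path_comp_trivial eqxx big1 ?addr0 // => i ne.
by rewrite path_mul_elt /path_mulb path_comp_trivial eq_sym (negPf ne).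
Qed.

Lemma path_one_coef i : path_one@_(trivial_path i) = 1.
Proof.
rewrite /path_one raddf_sum (bigD1 i) //= path_eltE mcoeffUU big1 ?addr0 //.
move=> j ne; rewrite path_eltE mcoeffU; case: eqP => // /(congr1 path_target) e.
by rewrite -[j]/(path_target (trivial_path j)) e eqxx in ne.
Qed.

Lemma path_one_neq0 : path_one != 0.
Proof.
apply/eqP => /(congr1 (mcoeff (trivial_path ord0))) /eqP.
by rewrite path_one_coef mcoeff0 oner_eq0.
Qed.

HB.instance Definition _ := GRing.Zmodule_isNzRing.Build path_alg
  path_mulA path_mul1 path_mulr1 path_mulDl path_mulDr path_one_neq0.
HB.instance Definition _ := GRing.Lmodule_isLalgebra.Build k path_alg
  (fun c f g => esym (path_mulZl c f g)).
HB.instance Definition _ := GRing.Lalgebra_isAlgebra.Build k path_alg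
  (fun c f g => esym (path_mulZr c f g)).

Definition path_vtx i : path_alg := path_elt (trivial_path i).
Definition path_arrow (a : arrow Q) : path_alg := path_elt (arrow_path a).

(* The one-dimensional representation concentrated at a vertex, on which every
   arrow vanishes. *)
Definition path_char i (f : path_alg) : k^o := f@_(trivial_path i).

Fact path_char_is_zmod_morphism i : zmod_morphism (path_char i).
Proof. move=> f g; exact: mcoeffB. Qed.
Fact path_char_is_scalable i : scalable (path_char i).
Proof. move=> c f; exact: mcoeffZ. Qed.

HB.instance Definition _ i := GRing.isZmodMorphism.Build path_alg k^o
  (path_char i) (path_char_is_zmod_morphism i).
HB.instance Definition _ i := GRing.isScalable.Build k path_alg k^o *:%R
  (path_char i) (path_char_is_scalable i).

Lemma path_char_elt i p : path_char i (path_elt p) = (p == trivial_path i)%:R.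
Proof. rewrite path_eltE; exact: (mcoeffU p 1 (trivial_path i)). Qed.

Lemma path_char_mulb i p q :
  path_char i (path_mulb p q) = path_char i (path_elt p) * path_char i (path_elt q).
Proof.
rewrite !path_char_elt /path_mulb.
have [->|np] := eqVneq p (trivial_path i).
  rewrite trivial_path_comp mul1r; case: (eqVneq q (trivial_path i)) => [->|nq].
    by rewrite eqxx path_char_elt eqxx.
  case: ifP; rewrite ?path_char_elt ?(negPf nq) // => _.
  exact: raddf0.
rewrite mul0r; case E: (path_comp p q) => [r|]; last exact: raddf0.
rewrite path_char_elt; case: eqP => // er; have [_] := (path_compE _ _ _).1 E.
rewrite er; case: p np {E} => [[j [|a s]] wf] //= ne [e _].
by case/eqP: ne; apply: val_inj; rewrite /= e.
Qed.

Fact path_char_is_monoid_morphism i : monoid_morphism (path_char i).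
Proof.
split=> [|f g]; first exact: path_one_coef.
rewrite [f * g]/(path_mul f g); move: f; apply: path_alg_ext => [c f f'|c f f'|p].
- exact: etrans (congr1 (path_char i) (path_mul_linearl g c f f')) (linearP _ _ _ _).
- by rewrite linearP mulrDl scalerAl.
move: g; apply: path_alg_ext => [c g g'|c g g'|q].
- exact: etrans (congr1 (path_char i) (path_mul_linearr _ c g g')) (linearP _ _ _ _).
- by rewrite linearP mulrDr scalerAr.
exact: etrans (congr1 (path_char i) (path_mul_elt p q)) (path_char_mulb i p q).
Qed.
HB.instance Definition _ i := GRing.isMonoidMorphism.Build path_alg k^o
  (path_char i) (path_char_is_monoid_morphism i).

End PathAlgebra.

Arguments path_vtx : clear implicits.
Arguments path_arrow : clear implicits.

Lemma path_elt_mul (k : fieldType) (Q : quiver) (p q : qpath Q) :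
  path_elt k p * path_elt k q =
  if path_comp p q is Some r then path_elt k r else 0.
Proof. exact: path_mul_elt. Qed.

Section Localization.
Variables (k : fieldType) (A : algType k) (I : choiceType) (s : I -> A).

Local Notation F := (free_alg k (A + I)%type).
Local Notation cst x := (free_gen k (inl x : (A + I)%type)).
Local Notation inv i := (free_gen k (inr i : (A + I)%type)).

(* The first four families make [x |-> cst x] a morphism of k-algebras, the
   last two make [inv i] a two-sided inverse of the image of [s i]. *)
Inductive loc_rel : F -> Prop :=
| loc_relD x y : loc_rel (cst (x + y) - (cst x + cst y))
| loc_relZ c x : loc_rel (cst (c *: x) - c *: cst x)
| loc_relM x y : loc_rel (cst (x * y) - cst x * cst y)
| loc_rel1 : loc_rel (cst 1 - 1)
| loc_relV i : loc_rel (inv i * cst (s i) - 1)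
| loc_relVr i : loc_rel (cst (s i) * inv i - 1).

Section Lift.
Variables (B : algType k) (f : {lrmorphism A -> B}) (t : I -> B).
Hypothesis tV : forall i, t i * f (s i) = 1 /\ f (s i) * t i = 1.

Definition loc_gen_eval : F -> B :=
  free_eval (fun x : (A + I)%type => match x with inl a => f a | inr i => t i end).
HB.instance Definition _ := GRing.LRMorphism.on loc_gen_eval.

Lemma loc_gen_eval_rel x : loc_rel x -> loc_gen_eval x = 0.
Proof.
have E y : loc_gen_eval (free_gen k y) =
    match y with inl a => f a | inr i => t i end by exact: free_eval_gen.
case=> [y z|c y|y z||i|i]; rewrite rmorphB /=; apply/eqP; rewrite subr_eq0.
- by rewrite rmorphD /= !E rmorphD.
- by rewrite linearZ /= !E linearZ.
- by rewrite rmorphM /= !E rmorphM.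
- by rewrite E !rmorph1.
- by rewrite rmorph1 rmorphM /= !E; apply/eqP; exact: (tV i).1.
- by rewrite rmorph1 rmorphM /= !E; apply/eqP; exact: (tV i).2.
Qed.

Lemma loc_proper : ~ ideal_gen loc_rel 1.
Proof. exact: ideal_gen_proper loc_gen_eval_rel. Qed.
End Lift.

Definition localization (pr : ~ ideal_gen loc_rel 1) := quot_alg pr.
HB.instance Definition _ pr := GRing.Algebra.on (localization pr).

Section Structure.
Variable pr : ~ ideal_gen loc_rel 1.

Definition loc_in (x : A) : localization pr := quot_pi pr (cst x).
Definition loc_inv (i : I) : localization pr := quot_pi pr (inv i).

Lemma loc_rel_eq x y : loc_rel (x - y) -> quot_pi pr x = quot_pi pr y.
Proof. by move=> r; apply/quot_pi_eq; apply: ideal_gen_sub. Qed.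

Fact loc_in_is_zmod_morphism : zmod_morphism loc_in.
Proof.
have D x y : loc_in (x + y) = loc_in x + loc_in y.
  by rewrite [LHS](loc_rel_eq (loc_relD x y)) rmorphD.
by move=> x y; apply/eqP; rewrite eq_sym subr_eq -D subrK.
Qed.
Fact loc_in_is_monoid_morphism : monoid_morphism loc_in.
Proof.
split=> [|x y]; first by rewrite [LHS](loc_rel_eq loc_rel1) rmorph1.
by rewrite [LHS](loc_rel_eq (loc_relM x y)) rmorphM.
Qed.
Fact loc_in_is_scalable : scalable loc_in.
Proof. by move=> c x; rewrite [LHS](loc_rel_eq (loc_relZ c x)) linearZ. Qed.
HB.instance Definition _ := GRing.isZmodMorphism.Build A (localization pr)
  loc_in loc_in_is_zmod_morphism.
HB.instance Definition _ := GRing.isMonoidMorphism.Build A (localization pr)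
  loc_in loc_in_is_monoid_morphism.
HB.instance Definition _ := GRing.isScalable.Build k A (localization pr) *:%R
  loc_in loc_in_is_scalable.

Lemma loc_mulVr i : loc_inv i * loc_in (s i) = 1.
Proof.
exact: etrans (esym (rmorphM (quot_pi pr) _ _))
  (etrans (loc_rel_eq (loc_relV i)) (rmorph1 _)).
Qed.
Lemma loc_mulrV i : loc_in (s i) * loc_inv i = 1.
Proof.
exact: etrans (esym (rmorphM (quot_pi pr) _ _))
  (etrans (loc_rel_eq (loc_relVr i)) (rmorph1 _)).
Qed.

Section Lift.
Variables (B : algType k) (f : {lrmorphism A -> B}) (t : I -> B).
Hypothesis tV : forall i, t i * f (s i) = 1 /\ f (s i) * t i = 1.

Definition loc_lift : localization pr -> B := quot_lift (loc_gen_eval_rel tV).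
HB.instance Definition _ := GRing.LRMorphism.on loc_lift.

Lemma loc_liftE x : loc_lift (loc_in x) = f x.
Proof. by rewrite /loc_lift quot_liftE [LHS]free_eval_gen. Qed.
Lemma loc_liftV i : loc_lift (loc_inv i) = t i.
Proof. by rewrite /loc_lift quot_liftE [LHS]free_eval_gen. Qed.
End Lift.
End Structure.
End Localization.

Section MultiplicativePreprojective.
Variables (k : fieldType) (Q : quiver).

Local Notation dQ := (double_quiver Q).
Local Notation kdQ := (path_alg k dQ).

Definition one_add_aastar (a : arrow dQ) : kdQ :=
  1 + path_arrow k dQ a * path_arrow k dQ (star a).

Lemma path_char_one_add_aastar i a : path_char i (one_add_aastar a) = 1.
Proof.
rewrite rmorphD rmorph1 rmorphM /= /path_arrow path_char_elt.
case: eqP => [/(congr1 (fun p => size (val p).2))//|_].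
by rewrite mul0r addr0.
Qed.

Fact LQ_lift_subproof i (a : arrow dQ) : (1 : k^o) * path_char i (one_add_aastar a) = 1
  /\ path_char i (one_add_aastar a) * 1 = 1.
Proof. by rewrite path_char_one_add_aastar mulr1. Qed.

Fact LQ_proper : ~ ideal_gen (loc_rel one_add_aastar) 1.
Proof. exact: loc_proper (LQ_lift_subproof ord0). Qed.

(* L_Q *)
Definition LQ := localization LQ_proper.
HB.instance Definition _ := GRing.Algebra.on LQ.

Definition LQ_in : kdQ -> LQ := loc_in LQ_proper.
HB.instance Definition _ := GRing.LRMorphism.on LQ_in.

Definition LQ_char (i : vertex dQ) : LQ -> k^o := loc_lift (LQ_lift_subproof i).
HB.instance Definition _ i := GRing.LRMorphism.on (LQ_char i).

(* loc_inv LQ_proper a is (1 + a a^* )^-1. *)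
Definition rho_factor (a : arrow dQ) : LQ :=
  match a with
  | inl _ => LQ_in (one_add_aastar a)
  | inr _ => loc_inv LQ_proper a
  end.

Definition rho (le : rel (arrow dQ)) : LQ :=
  \prod_(a <- sort le (enum (arrow dQ))) rho_factor a.

Section Quotient.
Variable le : rel (arrow dQ).

Definition rho_rel (x : LQ) : Prop := x = rho le - 1.

Lemma LQ_char_rho i x : rho_rel x -> LQ_char i x = 0.
Proof.
move=> ->; rewrite rmorphB rmorph1 rmorph_prod big1 ?subrr // => a _.
rewrite /rho_factor; case: a => a; last exact: loc_liftV.
exact: etrans (loc_liftE _ _ _) (path_char_one_add_aastar _ _).
Qed.

Fact mpa_proper : ~ ideal_gen rho_rel 1.
Proof. exact: ideal_gen_proper (LQ_char_rho ord0). Qed.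

(* Lambda^1(Q) *)
Definition mpa := quot_alg mpa_proper.
HB.instance Definition _ := GRing.Algebra.on mpa.

Definition mpa_in : kdQ -> mpa := quot_pi mpa_proper \o LQ_in.
HB.instance Definition _ := GRing.LRMorphism.on mpa_in.

(* Images of the vertex idempotents, giving the k Q_0-algebra structure. *)
Definition mpa_vtx (i : vertex Q) : mpa := mpa_in (path_vtx k dQ i).

Definition mpa_char (i : vertex Q) : mpa -> k^o :=
  quot_lift (LQ_char_rho (i : vertex dQ)).
HB.instance Definition _ i := GRing.LRMorphism.on (mpa_char i).

Lemma mpa_char_vtx i j : mpa_char i (mpa_vtx j) = (j == i)%:R.
Proof.
rewrite [LHS]quot_liftE [LHS]loc_liftE [LHS]path_char_elt.
by congr (nat_of_bool _)%:R; apply/eqP/eqP => [/(congr1 (@path_target _))|->].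
Qed.
End Quotient.
End MultiplicativePreprojective.

Section RepresentationScheme.
Variables (k : fieldType) (A : algType k) (m : nat) (e : 'I_m.+1 -> A).

(* R-points: morphisms of k-algebras from A to End_R(R^(m+1)) under which e i
   acts as the projection onto the i-th coordinate. *)
Record rep (R : comAlgType k) := Rep {
  rep_fun :> {lrmorphism A -> 'M[R]_m.+1 | GRing.in_alg R \; *:%R};
  repP : forall i, rep_fun (e i) = delta_mx i i }.

Local Notation X := (A * ('I_m.+1 * 'I_m.+1))%type.
Local Notation P := (poly_alg k X).
Local Notation gen x i j := (poly_gen k ((x, (i, j)) : X)).

(* The coordinate ring is generated by the matrix entries [gen x i j] of the
   universal representation. *)
Inductive rep_rel : P -> Prop :=
| rep_relD x y i j : rep_rel (gen (x + y) i j - (gen x i j + gen y i j))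
| rep_relZ c x i j : rep_rel (gen (c *: x) i j - c *: gen x i j)
| rep_relM x y i j : rep_rel (gen (x * y) i j - \sum_l gen x i l * gen y l j)
| rep_rel1 i j : rep_rel (gen 1 i j - (i == j)%:R)
| rep_relE v i j : rep_rel (gen (e v) i j - ((i == v) && (j == v))%:R).

Section Eval.
Variables (R : comAlgType k) (r : rep R).

Definition rep_gen_eval : P -> R := poly_eval (fun t : X => r t.1 t.2.1 t.2.2).
HB.instance Definition _ := GRing.LRMorphism.on rep_gen_eval.

Lemma rep_gen_eval_gen x i j : rep_gen_eval (gen x i j) = r x i j.
Proof. exact: poly_eval_gen. Qed.

Lemma rep_gen_eval_rel f : rep_rel f -> rep_gen_eval f = 0.
Proof.
have E := rep_gen_eval_gen.
have B u v : rep_gen_eval u = rep_gen_eval v -> rep_gen_eval (u - v) = 0.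
  by move=> uv; rewrite rmorphB /= uv subrr.
have nat n : rep_gen_eval n%:R = n%:R by exact: rmorph_nat.
case=> [x y i j|c x i j|x y i j|i j|v i j]; apply: B; rewrite [LHS]E.
- by rewrite [RHS]rmorphD /= [in RHS]E [in RHS]E rmorphD mxE.
- by rewrite [RHS]linearZ /= [in RHS]E linearZ /= mxE mulr_algl.
- rewrite [RHS]rmorph_sum rmorphM mxE.
  by apply: eq_bigr => l _; rewrite [RHS]rmorphM /= [in RHS]E [in RHS]E.
- by rewrite [RHS]nat rmorph1 mxE.
- by rewrite [RHS]nat repP mxE.
Qed.

Lemma rep_proper : ~ ideal_gen rep_rel 1.
Proof. exact: ideal_gen_proper rep_gen_eval_rel. Qed.
End Eval.

Section CoordinateRing.
Variable pr : ~ ideal_gen rep_rel 1.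

Definition rep_ring := quot_alg pr.
HB.instance Definition _ := GRing.Algebra.on rep_ring.

Fact rep_ring_mulC : commutative (@GRing.mul rep_ring).
Proof.
move=> u v; have [[x <-] [y <-]] := (quot_piP u, quot_piP v).
by rewrite -!(rmorphM (quot_pi pr)) mulrC.
Qed.
HB.instance Definition _ :=
  GRing.PzRing_hasCommutativeMul.Build rep_ring rep_ring_mulC.

Definition rep_ev (x : A) : 'M[rep_ring]_m.+1 :=
  \matrix_(i, j) quot_pi pr (gen x i j).

(* The value of the function f at the R-point r. *)
Definition rep_at (R : comAlgType k) (r : rep R) : rep_ring -> R :=
  quot_lift (@rep_gen_eval_rel R r).
HB.instance Definition _ R r := GRing.LRMorphism.on (@rep_at R r).

Lemma rep_at_ev (R : comAlgType k) (r : rep R) x :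
  map_mx (rep_at r) (rep_ev x) = r x.
Proof.
by apply/matrixP => i j; rewrite !mxE [LHS]quot_liftE [LHS]rep_gen_eval_gen.
Qed.

Lemma rep_ring_ext (R : comAlgType k) (f g : {lrmorphism rep_ring -> R}) :
  (forall x, map_mx f (rep_ev x) = map_mx g (rep_ev x)) -> f =1 g.
Proof.
move=> fg u; have [p <-] := quot_piP u.
pose f' : {lrmorphism P -> R} := f \o quot_pi pr.
pose g' : {lrmorphism P -> R} := g \o quot_pi pr.
apply: (@poly_alg_ext k X R f' g') => -[x [i j]].
by have /matrixP/(_ i j) := fg x; rewrite !mxE.
Qed.

Lemma rep_ev_is_zmod_morphism : zmod_morphism rep_ev.
Proof.
have D x y : rep_ev (x + y) = rep_ev x + rep_ev y.
  apply/matrixP => i j; rewrite !mxE -[RHS]rmorphD; apply/quot_pi_eq.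
  by apply: ideal_gen_sub; apply: rep_relD.
by move=> x y; apply/eqP; rewrite eq_sym subr_eq -D subrK.
Qed.
Lemma rep_ev_is_monoid_morphism : monoid_morphism rep_ev.
Proof.
split=> [|x y]; apply/matrixP => i j.
  rewrite !mxE -[RHS](rmorph_nat (quot_pi pr)); apply/quot_pi_eq.
  by apply: ideal_gen_sub; apply: rep_rel1.
rewrite !mxE; under eq_bigr => l _ do rewrite !mxE -[_ * _](rmorphM (quot_pi pr)).
rewrite -[RHS](rmorph_sum (quot_pi pr)); apply/quot_pi_eq.
by apply: ideal_gen_sub; apply: rep_relM.
Qed.
Lemma rep_ev_is_scalable :
  scalable_for (GRing.in_alg rep_ring \; *:%R) rep_ev.
Proof.
move=> c x; apply/matrixP => i j; rewrite !mxE mulr_algl -[RHS]linearZ.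
by apply/quot_pi_eq; apply: ideal_gen_sub; apply: rep_relZ.
Qed.
HB.instance Definition _ := GRing.isZmodMorphism.Build A 'M[rep_ring]_m.+1
  rep_ev rep_ev_is_zmod_morphism.
HB.instance Definition _ := GRing.isMonoidMorphism.Build A 'M[rep_ring]_m.+1
  rep_ev rep_ev_is_monoid_morphism.
HB.instance Definition _ := GRing.isScalable.Build k A 'M[rep_ring]_m.+1
  (GRing.in_alg rep_ring \; *:%R) rep_ev rep_ev_is_scalable.

Lemma rep_ev_vtx v : rep_ev (e v) = delta_mx v v.
Proof.
apply/matrixP => i j; rewrite !mxE -[RHS](rmorph_nat (quot_pi pr)).
by apply/quot_pi_eq; apply: ideal_gen_sub; apply: rep_relE.
Qed.

(* The universal representation. *)
Definition univ_rep : rep rep_ring := @Rep rep_ring rep_ev rep_ev_vtx.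

(* R-points of GL_delta, with the inverse as part of the data. *)
Record GLdelta (R : comAlgType k) := MkGLdelta {
  gl_val : 'rV[R]_m.+1;
  gl_inv : 'rV[R]_m.+1;
  gl_mulV : forall i, gl_val 0 i * gl_inv 0 i = 1 }.

Section Action.
Variables (R : comAlgType k) (g : GLdelta R) (r : rep R).

Definition gl_act_fun (x : A) : 'M[R]_m.+1 :=
  diag_mx (gl_val g) *m r x *m diag_mx (gl_inv g).

Lemma gl_diagV : diag_mx (gl_inv g) *m diag_mx (gl_val g) = 1%:M.
Proof.
apply/matrixP => i j; rewrite mul_diag_mx !mxE.
by case: eqP => [->|_]; rewrite ?mulr0n ?mulr0 // mulr1n mulrC gl_mulV.
Qed.
Lemma gl_diagVr : diag_mx (gl_val g) *m diag_mx (gl_inv g) = 1%:M.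
Proof. exact: mulmx1C gl_diagV. Qed.

Fact gl_act_is_zmod_morphism : zmod_morphism gl_act_fun.
Proof. by move=> x y; rewrite /gl_act_fun rmorphB mulmxBr mulmxBl. Qed.
Fact gl_act_is_monoid_morphism : monoid_morphism gl_act_fun.
Proof.
split=> [|x y]; first by rewrite /gl_act_fun rmorph1 mulmx1 gl_diagVr.
have conjM (M N : 'M[R]_m.+1) (D := diag_mx (gl_val g)) (D' := diag_mx (gl_inv g)) :
    D *m (M *m N) *m D' = (D *m M *m D') *m (D *m N *m D').
  by rewrite !mulmxA -[D *m M *m D' *m D]mulmxA gl_diagV mulmx1.
by rewrite /gl_act_fun rmorphM; exact: conjM.
Qed.
Fact gl_act_is_scalable : scalable_for (GRing.in_alg R \; *:%R) gl_act_fun.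
Proof. by move=> c x; rewrite /gl_act_fun linearZ /= -scalemxAr -scalemxAl. Qed.
HB.instance Definition _ := GRing.isZmodMorphism.Build A 'M[R]_m.+1
  gl_act_fun gl_act_is_zmod_morphism.
HB.instance Definition _ := GRing.isMonoidMorphism.Build A 'M[R]_m.+1
  gl_act_fun gl_act_is_monoid_morphism.
HB.instance Definition _ := GRing.isScalable.Build k A 'M[R]_m.+1
  (GRing.in_alg R \; *:%R) gl_act_fun gl_act_is_scalable.

Fact gl_act_vtx i : gl_act_fun (e i) = delta_mx i i.
Proof.
rewrite /gl_act_fun repP; apply/matrixP => a b.
rewrite mul_mx_diag mxE mul_diag_mx !mxE.
case: eqP => [->|_]; last by rewrite mulr0 mul0r.
by case: eqP => [->|_]; rewrite ?mulr0 ?mul0r // mulr1 gl_mulV.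
Qed.

Definition gl_act : rep R := @Rep R gl_act_fun gl_act_vtx.
End Action.

(* Invariance in the sense of group schemes: it is tested on R-points for all
   R, since the k-points do not suffice when k is finite. *)
Definition gl_invariant : {pred rep_ring} := fun f =>
  `[< forall (R : comAlgType k) (g : GLdelta R) (r : rep R),
        rep_at (gl_act g r) f = rep_at r f >].

Fact gl_invariant_subalg : GRing.subalg_closed gl_invariant.
Proof.
split=> [|c u v /asboolP iu /asboolP iv|u v /asboolP iu /asboolP iv];
  apply/asboolP => R g r.
- by rewrite !rmorph1.
- by rewrite !linearP /= iu iv.
- by rewrite !rmorphM /= iu iv.
Qed.
HB.instance Definition _ := GRing.isSubalgClosed.Build k rep_ring gl_invariant
  gl_invariant_subalg.

Definition invariant_ring := {f : rep_ring | f \in gl_invariant}.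
HB.instance Definition _ := SubChoice.on invariant_ring.
HB.instance Definition _ :=
  [SubChoice_isSubComNzRing of invariant_ring by <:].
HB.instance Definition _ := [SubZmodule_isSubLmodule of invariant_ring by <:].
HB.instance Definition _ :=
  [SubNzRing_SubLmodule_isSubLalgebra of invariant_ring by <:].
HB.instance Definition _ := [SubLalgebra_isSubAlgebra of invariant_ring by <:].
End CoordinateRing.
End RepresentationScheme.

Section Center.
Variables (k : fieldType) (A : algType k).

Definition alg_central : {pred A} := fun z => `[< forall x, z * x = x * z >].

Fact alg_central_subalg : GRing.subalg_closed alg_central.
Proof.
split=> [|c u v /asboolP zu /asboolP zv|u v /asboolP zu /asboolP zv];
  apply/asboolP => x.
- by rewrite mul1r mulr1.
- by rewrite mulrDl mulrDr -scalerAl -scalerAr zu zv.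
- by rewrite -mulrA zv mulrA zu mulrA.
Qed.
HB.instance Definition _ := GRing.isSubalgClosed.Build k A alg_central alg_central_subalg.

Definition alg_center := {z : A | z \in alg_central}.
HB.instance Definition _ := SubChoice.on alg_center.
HB.instance Definition _ := [SubChoice_isSubNzRing of alg_center by <:].
HB.instance Definition _ := [SubZmodule_isSubLmodule of alg_center by <:].
HB.instance Definition _ := [SubNzRing_SubLmodule_isSubLalgebra of alg_center by <:].
HB.instance Definition _ := [SubLalgebra_isSubAlgebra of alg_center by <:].
End Center.

Section QuiverVariety.
Variables (k : fieldType) (Q : quiver) (le : rel (arrow (double_quiver Q))).
Local Notation L := (mpa k le).
Local Notation e := (@mpa_vtx k Q le).
Local Notation N := (nvertex Q).

(* The representation on which every arrow vanishes. *)
Definition zero_rep_fun (x : L) : 'M[k^o]_N.+1 :=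
  diag_mx (\row_i mpa_char i x).

Fact zero_rep_is_zmod_morphism : zmod_morphism zero_rep_fun.
Proof.
move=> x y; apply/matrixP => i j.
by rewrite !mxE rmorphB mulrnBl.
Qed.
Fact zero_rep_is_monoid_morphism : monoid_morphism zero_rep_fun.
Proof.
split=> [|x y]; apply/matrixP => i j; first by rewrite !mxE rmorph1.
rewrite -[RHS]/((zero_rep_fun x *m zero_rep_fun y) i j).
rewrite mul_diag_mx !mxE rmorphM.
by case: eqP => [->|_]; rewrite ?mulr0n ?mulr0 // !mulr1n.
Qed.
Fact zero_rep_is_scalable :
  scalable_for (GRing.in_alg k^o \; *:%R) zero_rep_fun.
Proof.
by move=> c x; apply/matrixP => i j; rewrite !mxE linearZ /= mulrnAr mulr_algl.
Qed.
HB.instance Definition _ := GRing.isZmodMorphism.Build L 'M[k^o]_N.+1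
  zero_rep_fun zero_rep_is_zmod_morphism.
HB.instance Definition _ := GRing.isMonoidMorphism.Build L 'M[k^o]_N.+1
  zero_rep_fun zero_rep_is_monoid_morphism.
HB.instance Definition _ := GRing.isScalable.Build k L 'M[k^o]_N.+1
  (GRing.in_alg k^o \; *:%R) zero_rep_fun zero_rep_is_scalable.

Fact zero_rep_vtx i : zero_rep_fun (e i) = delta_mx i i.
Proof.
apply/matrixP => a b; rewrite !mxE mpa_char_vtx [i == a]eq_sym.
have [->|ne] := eqVneq a b; first by rewrite mulr1n andbb.
by rewrite mulr0n; have [<-|//] := eqVneq a i; rewrite eq_sym (negPf ne).
Qed.
Definition zero_rep : rep e k^o := @Rep k L _ e k^o zero_rep_fun zero_rep_vtx.

Fact mqv_proper : ~ ideal_gen (rep_rel e) 1.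
Proof. exact: rep_proper zero_rep. Qed.

(* k[Rep_delta(Lambda^1(Q))] *)
Definition mpa_rep_ring := rep_ring mqv_proper.
HB.instance Definition _ := GRing.ComAlgebra.on mpa_rep_ring.

Definition mpa_ev : L -> 'M[mpa_rep_ring]_N.+1 := rep_ev mqv_proper.

(* k[M_(1,0)(Q, delta)] = k[Rep_delta(Lambda^1(Q))]^GL_delta *)
Definition mqv_ring := invariant_ring mqv_proper.
HB.instance Definition _ := SubChoice.on mqv_ring.
HB.instance Definition _ := GRing.ComAlgebra.on mqv_ring.
End QuiverVariety.

(* The quiver with n + 1 vertices and n + 1 arrows whose underlying graph is a
   cycle: the i-th arrow joins i and i + 1 modulo n + 1, and o i tells whether
   it goes from i to i + 1 or from i + 1 to i. *)
Definition Atilde (n : nat) (o : 'I_n.+1 -> bool) : quiver :=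
  @Quiver n 'I_n.+1
    (fun i => if o i then i else ordS i)
    (fun i => if o i then ordS i else i).

Arguments Atilde : clear implicits.
Arguments mpa : clear implicits.
Arguments alg_center {k} A.
Arguments mpa_ev : clear implicits.
Arguments mqv_ring : clear implicits.

(* Main.v *)
(* Replace the arrow y_i : i+1 -> i of the double quiver by -(1 + y_i x_i)^-1 y_i
   whenever the i-th arrow of the cycle is reversed.  The relation rho = 1 then
   says x_{i-1} y_{i-1} = y_i x_i at every vertex, that is, xy = yx for
   x = sum_i x_i and y = sum_i y_i.  So Lambda^1(Q) is spanned by the elements
   (1 + xy)^-M x^a y^b e_i, and x |-> X * shift, y |-> Y * shift^-1 is a
   representation over k(X, Y) in which, up to powers of 1 + xy, they are
   linearly independent; in particular ev is injective.

   Comparing matrix entries in that representation, a central z satisfies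
   (1 + xy)^M z = sum_i e_i D(x, y) e_i with one polynomial D for all i, and only
   the monomials x^a y^b with a = b modulo n + 1 survive; these are products of
   the central elements xy, x^(n+1) and y^(n+1), so ev z is scalar.

   Conversely k[Rep] is spanned over the image of the center by the monomials
   prod_i p_i^(a_i) q_i^(b_i) in the nonzero entries p_i, q_i of ev x, ev y.  An
   invariant only involves monomials of weight 0 under GL_delta, those with
   a_i - b_i independent of i, and they lie in the algebra generated by
   p_i q_i = ev_Z(xy), prod_i p_i = ev_Z(x^(n+1)) and prod_i q_i = ev_Z(y^(n+1)). *)

Require Import Defs.
From HB Require Import structures.
From mathcomp Require Import all_boot all_order all_algebra.
From mathcomp Require Import boolp monalg.
From mathcomp Require Import qpoly ring zify.

Set Implicit Arguments.
Unset Strict Implicit.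
Unset Printing Implicit Defensive.

Import GRing.Theory.
Local Open Scope ring_scope.

(** * Scalars through a central morphism, and base change of representations *)

Section AlgebraVia.
Variables (k : fieldType) (D : nzRingType) (phi : {rmorphism k -> D}).
Hypothesis phiC : forall c x, phi c * x = x * phi c.

(** The type is [D] itself; the centrality proof is a phantom argument, through which the instances
    below depend on [phi]. *)
Definition alg_via of (forall c x, phi c * x = x * phi c) : Type := D.
Local Notation DA := (alg_via phiC).
HB.instance Definition _ := GRing.NzRing.on DA.

Definition via_scale (c : k) (x : DA) : DA := (phi c : DA) * x.
Fact via_scaleA c d u : via_scale c (via_scale d u) = via_scale (c * d) u.
Proof. by rewrite /via_scale (rmorphM phi) -mulrA. Qed.
Fact via_scale1 : left_id 1 via_scale.
Proof. by move=> u; rewrite /via_scale rmorph1 mul1r. Qed.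
Fact via_scaleDr : right_distributive via_scale +%R.
Proof. by move=> c u v; rewrite /via_scale mulrDr. Qed.
Fact via_scaleDl u : {morph via_scale^~ u : c d / c + d >-> c + d}.
Proof. by move=> c d; rewrite /via_scale rmorphD mulrDl. Qed.
HB.instance Definition _ := GRing.Zmodule_isLmodule.Build k DA
  via_scaleA via_scale1 via_scaleDr via_scaleDl.
Fact via_scaleAl (c : k) (u v : DA) : c *: (u * v) = (c *: u) * v.
Proof. exact: (mulrA (phi c : DA) u v). Qed.
HB.instance Definition _ := GRing.Lmodule_isLalgebra.Build k DA via_scaleAl.
Fact via_scaleAr (c : k) (u v : DA) : c *: (u * v) = u * (c *: v).
Proof.
rewrite [LHS](mulrA (phi c : DA) u v) [(phi c : DA) * u](phiC c u).
exact: esym (mulrA u (phi c : DA) v).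
Qed.
HB.instance Definition _ := GRing.Lalgebra_isAlgebra.Build k DA via_scaleAr.

End AlgebraVia.

Section ComAlgebraVia.
Variables (k : fieldType) (D : comNzRingType) (phi : {rmorphism k -> D}).

Definition comalg_via of {rmorphism k -> D} : Type := D.
Local Notation DA := (comalg_via phi).
Fact via_comm c x : phi c * x = x * phi c. Proof. exact: mulrC. Qed.
HB.instance Definition _ := GRing.ComNzRing.on DA.
HB.instance Definition _ := GRing.Lalgebra.copy DA (alg_via via_comm).
HB.instance Definition _ :=
  GRing.Lalgebra_isAlgebra.Build k DA (@via_scaleAr _ _ _ via_comm).
Lemma via_algE (c : k) : c%:A = phi c :> DA.
Proof. exact: mulr1. Qed.

Variables (C : comAlgType k) (psi : {rmorphism C -> D}).
Hypothesis psiA : forall c, psi c%:A = phi c.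
Definition to_via : C -> DA := psi.
Fact to_via_is_zmod_morphism : zmod_morphism to_via.
Proof. exact: (rmorphB psi). Qed.
Fact to_via_is_monoid_morphism : monoid_morphism to_via.
Proof. by split; [exact: (rmorph1 psi)|exact: (rmorphM psi)]. Qed.
HB.instance Definition _ := GRing.isZmodMorphism.Build C DA to_via to_via_is_zmod_morphism.
HB.instance Definition _ := GRing.isMonoidMorphism.Build C DA to_via to_via_is_monoid_morphism.
Fact to_via_is_scalable : scalable to_via.
Proof. by move=> c f; rewrite -mulr_algl rmorphM /= [to_via c%:A](psiA c). Qed.
HB.instance Definition _ := GRing.isScalable.Build k C DA *:%R to_via to_via_is_scalable.
Definition to_via_lr : {lrmorphism C -> DA} := to_via.
End ComAlgebraVia.

Section MatrixAlgebra.
Variables (k : fieldType) (C : comAlgType k) (m : nat).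
Definition mx_phi : k -> 'M[C]_m.+1 := @scalar_mx C m.+1 \o in_alg C.
HB.instance Definition _ := GRing.RMorphism.on mx_phi.
Fact mx_phiC c (x : 'M[C]_m.+1) : mx_phi c * x = x * mx_phi c.
Proof. exact: (esym (scalar_mxC (in_alg C c) x)). Qed.
(* Matrices over C as a k-algebra; 'M[C]_m.+1 itself is only a C-algebra. *)
Definition kmx := alg_via mx_phiC.
HB.instance Definition _ := GRing.Algebra.on kmx.
End MatrixAlgebra.

(** Clears the negative part of the weight [a - b]: after multiplication by a large enough power of
    [T] only nonnegative exponents remain. *)
Fact shift_exp (R : comNzRingType) (T T' u : R) (a b d : nat) : T * T' = 1 ->
  T ^+ a * T' ^+ b * u * T ^+ (d + b) = u * T ^+ (a + d).
Proof.
move=> TT'; rewrite -[RHS]mulr1 -[X in _ = _ * X](expr1n _ b) -TT' exprMn !exprD.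
by ring.
Qed.

Section Reps.
Variables (k : fieldType) (A : algType k) (m : nat) (e : 'I_m.+1 -> A).

Section Operations.
Variables (C : comAlgType k) (r : rep e C).
Lemma repD a b : r (a + b) = r a + r b. Proof. exact: rmorphD. Qed.
Lemma repM a b : r (a * b) = r a *m r b. Proof. exact: rmorphM. Qed.
Lemma repX a d : r (a ^+ d) = r a ^+ d. Proof. exact: rmorphXn. Qed.
Lemma rep1 : r 1 = 1%:M. Proof. exact: rmorph1. Qed.
Lemma rep0 : r 0 = 0. Proof. exact: rmorph0. Qed.
Lemma rep_sum (I : Type) (l : seq I) (f : I -> A) :
  r (\sum_(s <- l) f s) = \sum_(s <- l) r (f s).
Proof. exact: raddf_sum. Qed.
Lemma repZ c a : r (c *: a) = c%:A *: r a. Proof. exact: linearZ. Qed.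
End Operations.

Section OfMorphism.
Variables (C : comAlgType k) (f : {lrmorphism A -> kmx C m}).
Hypothesis fe : forall i, f (e i) = delta_mx i i.
(** [rep] asks for semilinearity along [in_alg C] into ['M[C]_m.+1], whereas lifts from quotients
    and localizations take values in k-algebras, hence in [kmx]. *)
Definition rep_of_fun : A -> 'M[C]_m.+1 := f.
Fact rep_of_is_zmod_morphism : zmod_morphism rep_of_fun.
Proof. exact: (rmorphB f). Qed.
Fact rep_of_is_monoid_morphism : monoid_morphism rep_of_fun.
Proof. by split; [exact: (rmorph1 f)|exact: (rmorphM f)]. Qed.
Fact rep_of_is_scalable : scalable_for (GRing.in_alg C \; *:%R) rep_of_fun.
Proof.
move=> c x; by rewrite /rep_of_fun [LHS](linearZZ f) -[RHS]mul_scalar_mx.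
Qed.
HB.instance Definition _ := GRing.isZmodMorphism.Build A 'M[C]_m.+1
  rep_of_fun rep_of_is_zmod_morphism.
HB.instance Definition _ := GRing.isMonoidMorphism.Build A 'M[C]_m.+1
  rep_of_fun rep_of_is_monoid_morphism.
HB.instance Definition _ := GRing.isScalable.Build k A 'M[C]_m.+1
  (GRing.in_alg C \; *:%R) rep_of_fun rep_of_is_scalable.
Definition rep_of : rep e C := @Rep k A m e C rep_of_fun fe.
End OfMorphism.

Section BaseChange.
Variables (C C' : comAlgType k) (phi : {lrmorphism C -> C'}) (r : rep e C).
Definition rep_map_fun (x : A) : 'M[C']_m.+1 := map_mx phi (r x).
Fact rep_map_is_zmod_morphism : zmod_morphism rep_map_fun.
Proof. by move=> x y; rewrite /rep_map_fun rmorphB map_mxB. Qed.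
Fact rep_map_is_monoid_morphism : monoid_morphism rep_map_fun.
Proof.
split=> [|x y]; first by rewrite /rep_map_fun rmorph1 map_mx1.
by rewrite /rep_map_fun rmorphM; exact: map_mxM.
Qed.
Fact rep_map_is_scalable : scalable_for (GRing.in_alg C' \; *:%R) rep_map_fun.
Proof.
move=> c x; apply/matrixP => i j; rewrite !mxE linearZ /= mxE mulr_algl linearZ /=.
by rewrite mulr_algl.
Qed.
HB.instance Definition _ := GRing.isZmodMorphism.Build A 'M[C']_m.+1
  rep_map_fun rep_map_is_zmod_morphism.
HB.instance Definition _ := GRing.isMonoidMorphism.Build A 'M[C']_m.+1
  rep_map_fun rep_map_is_monoid_morphism.
HB.instance Definition _ := GRing.isScalable.Build k A 'M[C']_m.+1
  (GRing.in_alg C' \; *:%R) rep_map_fun rep_map_is_scalable.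
Fact rep_map_vtx i : rep_map_fun (e i) = delta_mx i i.
Proof. by rewrite /rep_map_fun repP map_delta_mx. Qed.
Definition rep_map : rep e C' := @Rep k A m e C' rep_map_fun rep_map_vtx.
End BaseChange.

(** * Torus weights *)

Section Torus.
Variable pr : ~ ideal_gen (rep_rel e) 1.
Local Notation B := (rep_ring pr).
Local Notation ev := (rep_ev pr).

(** The Yoneda correspondence: both sides are morphisms out of the coordinate ring with the same
    values on the universal matrix entries. *)
Lemma rep_at_map_univ (C : comAlgType k) (phi : {lrmorphism B -> C}) f :
  rep_at (rep_map phi (univ_rep pr)) f = phi f.
Proof.
suff: rep_at (rep_map phi (univ_rep pr)) =1 phi by apply.
by apply: rep_ring_ext => x; rewrite rep_at_ev.
Qed.

Section OneVertex.
Variables (C : comAlgType k) (T T' : C) (TT' : T * T' = 1) (i : 'I_m.+1).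
Fact torus_subproof j :
  (\row_l (if l == i then T else 1)) 0 j * (\row_l (if l == i then T' else 1)) 0 j
  = 1.
Proof. by rewrite !mxE; case: eqP => // _; rewrite mulr1. Qed.
Definition torus_elt : GLdelta m C := MkGLdelta torus_subproof.
End OneVertex.

(* The weight of f is the integer a - b, for the one-parameter subgroup that
   scales the i-th coordinate. *)
Definition has_weight i (a b : nat) (f : B) := forall (C : comAlgType k)
  (phi : {lrmorphism B -> C}) (T T' : C) (TT' : T * T' = 1),
  rep_at (gl_act (torus_elt TT' i) (rep_map phi (univ_rep pr))) f =
  T ^+ a * T' ^+ b * phi f.

Lemma gl_act_entry (C : comAlgType k) (g : GLdelta m C) (r : rep e C) x a b :
  gl_act g r x a b = gl_val g 0 a * r x a b * gl_inv g 0 b.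
Proof.
have -> : gl_act g r x = diag_mx (gl_val g) *m r x *m diag_mx (gl_inv g) by [].
by rewrite mul_mx_diag mxE mul_diag_mx mxE.
Qed.

Lemma rep_at_entry (C : comAlgType k) (r : rep e C) x a b :
  rep_at r (ev x a b) = r x a b.
Proof. by have /matrixP/(_ a b) := rep_at_ev pr r x; rewrite mxE. Qed.

Lemma has_weight_ev i x a b : has_weight i (a == i) (b == i) (ev x a b).
Proof.
move=> C phi T T' TT'; rewrite rep_at_entry gl_act_entry /= !mxE.
by rewrite mulrAC; congr (_ * _ * _); case: eqP.
Qed.

Lemma has_weight_diag i x a : has_weight i 0 0 (ev x a a).
Proof.
move=> C phi T T' TT'; rewrite rep_at_entry gl_act_entry /= !mxE !mul1r.
by rewrite mulrAC; case: eqP => _; rewrite ?TT' ?mulr1 ?mul1r.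
Qed.

Lemma has_weight1 i : has_weight i 0 0 1.
Proof. by move=> C phi T T' TT'; rewrite !rmorph1 !mul1r. Qed.

Lemma has_weightM i a b a' b' f f' : has_weight i a b f ->
  has_weight i a' b' f' -> has_weight i (a + a') (b + b') (f * f').
Proof.
move=> wf wf' C phi T T' TT'; rewrite !rmorphM /= wf wf' !exprD.
by rewrite mulrACA; congr (_ * _); rewrite mulrACA.
Qed.

Lemma has_weightX i a b f d : has_weight i a b f ->
  has_weight i (a * d) (b * d) (f ^+ d).
Proof.
move=> wf; elim: d => [|d IHd]; first by rewrite !muln0; exact: has_weight1.
by rewrite exprS !mulnS; exact: has_weightM.
Qed.

Lemma has_weight_prod i (I : Type) (l : seq I) (a b : I -> nat) (f : I -> B) :
  (forall s, has_weight i (a s) (b s) (f s)) ->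
  has_weight i (\sum_(s <- l) a s) (\sum_(s <- l) b s) (\prod_(s <- l) f s).
Proof.
move=> wf; elim: l => [|s l IHl]; first by rewrite !big_nil; exact: has_weight1.
by rewrite !big_cons; apply: has_weightM.
Qed.

Section RootsOfUnity.
Variables (M : nat).

(* In B[T] / (T^(M+1) - 1) the element T is invertible, and its powers separate
   the weights modulo M + 1. *)
Local Notation h := ('X^(M.+1) - 1 : {poly B}).
Local Notation D := {poly %/ h}.
Lemma size_mu : size h = M.+2.
Proof. by rewrite size_Xn_sub_1. Qed.
Lemma mk_monic_mu : mk_monic h = h.
Proof. by rewrite /mk_monic size_mu monic_Xn_sub_1. Qed.
(** Polynomials of degree at most M are their own remainders modulo [h]. *)
Lemma in_qpoly_mu_inj (p q : {poly B}) : (size p <= M.+1)%N -> (size q <= M.+1)%N ->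
  in_qpoly h p = in_qpoly h q -> p = q.
Proof.
move=> sp sq /(congr1 (@polyn _ _)).
by rewrite !in_qpoly_small ?mk_monic_mu ?size_mu.
Qed.
Definition mu_psi : B -> D := in_qpoly h \o polyC.
HB.instance Definition _ := GRing.RMorphism.on mu_psi.
Definition mu_phi : k -> D := mu_psi \o in_alg B.
HB.instance Definition _ := GRing.RMorphism.on mu_phi.
Definition mu_ring := comalg_via mu_phi.
HB.instance Definition _ := GRing.ComAlgebra.on mu_ring.
Definition mu_emb : {lrmorphism B -> mu_ring} :=
  @to_via_lr k D mu_phi B mu_psi (fun c => erefl).
Definition mu_T : mu_ring := in_qpoly h 'X.
Definition mu_T' : mu_ring := in_qpoly h 'X^M.
Lemma mu_TT' : mu_T * mu_T' = 1.
Proof.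
have h0 : in_qpoly h h = 0.
  by apply: val_inj; rewrite /= mk_monic_mu Pdiv.RingMonic.rmodpp // monic_Xn_sub_1.
apply: etrans (esym (rmorphM (in_qpoly h) 'X 'X^M)) _.
have -> : 'X * 'X^M = h + 1 by rewrite -exprS subrK.
apply: etrans (rmorphD (in_qpoly h) h 1) _.
apply: etrans (congr1 (fun u => u + in_qpoly h 1) h0) _.
exact: etrans (add0r _) (rmorph1 (in_qpoly h)).
Qed.
Lemma mu_monomial f d : (in_qpoly h (f%:P * 'X^d) : mu_ring) = mu_emb f * mu_T ^+ d.
Proof.
apply: etrans (rmorphM (in_qpoly h) _ _) _; congr (_ * _).
exact: (rmorphXn (in_qpoly h)).
Qed.
End RootsOfUnity.

(** Invariance under the point T of the one-parameter subgroup at [i] equates [F] with the sum of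
    the [f s] scaled by T^(a s - b s). After multiplication by T^K both sides are polynomials of
    degree at most M in T, and the coefficient of T^K selects the terms of weight 0. *)
Lemma invariant_weight0 i (I : eqType) (l : seq I) (a b : I -> nat) (f : I -> B) F :
  {in l, forall s, has_weight i (a s) (b s) (f s)} -> F = \sum_(s <- l) f s ->
  F \in gl_invariant (pr := pr) -> F = \sum_(s <- l | a s == b s) f s.
Proof.
move=> wf eF /asboolP invF.
(* K keeps the subtraction in [a s + (K - b s)] from truncating; M bounds these exponents and K
   itself, so that nothing wraps around modulo M + 1. *)
pose K := \max_(s <- l) b s; pose M := (\max_(s <- l) a s + K)%N.
have bK s : s \in l -> (b s <= K)%N by move=> sl; exact: leq_bigmax_seq.
have aM s : s \in l -> (a s + K <= M)%N.
  by move=> sl; rewrite leq_add2r; exact: (leq_bigmax_seq _ sl).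
have := invF _ (torus_elt (mu_TT' M) i) (rep_map (mu_emb M) (univ_rep pr)).
rewrite rep_at_map_univ {1}eF raddf_sum /=.
move=> /(congr1 (fun u => u * mu_T M ^+ K)); rewrite mulr_suml -mu_monomial.
rewrite (eq_big_seq (fun s => in_qpoly _ ((f s)%:P * 'X^(a s + (K - b s))) : mu_ring M));
    last first.
  by move=> s sl; rewrite wf // mu_monomial -{1}(subnK (bK s sl)) shift_exp // mu_TT'.
move=> E0; have E : in_qpoly ('X^(M.+1) - 1) (\sum_(s <- l) (f s)%:P * 'X^(a s + (K - b s)))
   = in_qpoly _ (F%:P * 'X^K).
  by rewrite -E0 raddf_sum.
have sz (g : B) d : (d <= M)%N -> (size (g%:P * 'X^d)%R <= M.+1)%N.
  move=> dM; apply: leq_trans (size_polyMleq _ _) _.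
  rewrite size_polyXn addnS /= -[M.+1]add1n.
  by apply: leq_add => //; exact: size_polyC_leq1.
have sF : (size (F%:P * 'X^K)%R <= M.+1)%N by apply: sz; rewrite leq_addl.
have sf : (size (\sum_(s <- l) (f s)%:P * 'X^(a s + (K - b s)))%R <= M.+1)%N.
  apply: leq_trans (size_sum _ _ _) _; apply/bigmax_leqP_seq => s sl _; apply: sz.
  by apply: leq_trans (aM s sl); rewrite leq_add2l leq_subr.
have /(congr1 (fun p : {poly B} => p`_K)) := in_qpoly_mu_inj sf sF E.
rewrite coefMXn ltnn subnn coefC eqxx => <-.
rewrite coef_sum [RHS]big_mkcond /=; apply: eq_big_seq => s sl.
rewrite coefMXn coefC.
(* The subtraction truncates, so this test accepts all exponents from K upwards; the next one
   discards those above K. What remains is the exponent K, that is [a s = b s]. *)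
rewrite (_ : (K - (a s + (K - b s)) == 0)%N = (b s <= a s)%N); last first.
  by rewrite subn_eq0; have := bK s sl; lia.
rewrite (_ : (K < a s + (K - b s))%N = (b s < a s)%N); last first.
  by have := bK s sl; lia.
by case: ltngtP.
Qed.

(** Conjugation by a diagonal matrix fixes the diagonal. Hence the scalar of a central element, read
    off there, is a function on the quotient. *)
Lemma gl_invariant_diag x i : ev x i i \in gl_invariant (pr := pr).
Proof.
apply/asboolP => C g r; rewrite !rep_at_entry gl_act_entry mulrAC.
by rewrite gl_mulV mul1r.
Qed.
End Torus.
End Reps.

(** * Algebras graded by the cyclic shift of the vertices *)

Lemma val_iter_ordS n (i : 'I_n.+1) d : iter d (@ordS _) i = ((i + d) %% n.+1)%N :> nat.
Proof.
elim: d => [|d IHd] /=; first by rewrite addn0 modn_small.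
by rewrite IHd -[in LHS]addn1 modnDml addn1 addnS.
Qed.

Lemma iter_ordS_eq n (i : 'I_n.+1) d : (iter d (@ordS _) i == i) = (n.+1 %| d)%N.
Proof.
rewrite -val_eqE /= val_iter_ordS -{2}[val i](modn_small (ltn_ord i)).
by rewrite -{2}[val i]addn0 eqn_modDl mod0n.
Qed.

Lemma ordS_const n (T : Type) (f : 'I_n.+1 -> T) :
  (forall i, f (ordS i) = f i) -> forall i, f i = f ord0.
Proof.
move=> fS i; have -> : i = iter i (@ordS _) ord0.
  by apply: val_inj; rewrite /= val_iter_ordS add0n modn_small.
by elim: (val i) => //= d <-.
Qed.

(** Moving the starting point one step carries the first factor to the end, so the product does not
    depend on [j]; from [ord0] the orbit lists the vertices in order. *)
Lemma prod_iter_ordS n (R : comNzRingType) (f : 'I_n.+1 -> R) j :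
  \prod_(l < n.+1) f (iter l (@ordS _) j) = \prod_i f i.
Proof.
pose g j := \prod_(l < n.+1) f (iter l (@ordS _) j).
have gS i : g (ordS i) = g i.
  rewrite /g [LHS]big_ord_recr [RHS]big_ord_recl mulrC; congr (_ * _).
    by apply: eq_bigr => l _; rewrite -iterSr.
  by congr (f _); rewrite -iterSr; apply/eqP; rewrite iter_ordS_eq.
rewrite -[LHS]/(g j) (ordS_const gS); apply: eq_bigr => l _; congr (f _).
by apply: val_inj; rewrite /= val_iter_ordS add0n modn_small.
Qed.

Lemma poly2_ind (R : nzRingType) (P : {poly {poly R}} -> Prop) : P 0 ->
  (forall p q, P p -> P q -> P (p + q)) ->
  (forall c a b, P (c%:P%:P * 'X^a * 'X%:P ^+ b)) -> forall p, P p.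
Proof.
move=> P0 PD PM p; rewrite -[p]coefK poly_def.
apply: big_ind => // a _; rewrite -[p`_a]coefK poly_def scaler_suml.
apply: big_ind => // b _.
rewrite (_ : _ *: _ = (p`_a`_b)%:P%:P * 'X^a * 'X%:P ^+ b) //.
rewrite -mulrA -!mul_polyC polyCM -mulrA polyC_exp; congr (_ * _).
by rewrite -!polyC_exp commr_polyXn.
Qed.

Lemma poly_alg_ind (k : fieldType) (X : choiceType) (P : poly_alg k X -> Prop) :
  (forall f g, P f -> P g -> P (f + g)) -> (forall f g, P f -> P g -> P (f * g)) ->
  (forall c, P c%:A) -> (forall t, P (poly_gen k t)) -> forall f, P f.
Proof.
move=> PD PM PC PX f; rewrite [f]monalgE.
apply: big_ind => // [|m _]; first by rewrite -(scale0r 1).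
rewrite malg_scaleU -mulr_algl; apply: (PM) => //.
elim/cmonom_ind: m => [|t m IHm]; first by rewrite -[<< _ >>]scale1r; exact: PC.
have -> : << mmul (ucm t) m >> = poly_gen k t * << m >> :> poly_alg k X.
  by rewrite poly_genE [RHS]malgM_def fgmulUU mul1r.
exact: PM.
Qed.

(** * Monomials in the arrow entries and the condition of weight zero *)

Section Monomials.
Variables (R : comNzRingType) (n : nat) (p q : 'I_n.+1 -> R) (C : R -> Prop).
Hypothesis CM : forall f g, C f -> C g -> C (f * g).
Hypothesis C1 : C 1.
Local Notation expo := {ffun 'I_n.+1 -> nat}.
(* (u, a, b) encodes u * prod_i p_i^(a_i) q_i^(b_i). *)
Definition mon (s : R * expo * expo) : R :=
  s.1.1 * \prod_i (p i ^+ s.1.2 i * q i ^+ s.2 i).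
Definition mon_mul (s t : R * expo * expo) : R * expo * expo :=
  (s.1.1 * t.1.1, [ffun i => s.1.2 i + t.1.2 i]%N, [ffun i => s.2 i + t.2 i]%N).
Lemma monM s t : mon (mon_mul s t) = mon s * mon t.
Proof.
rewrite /mon /= mulrACA -big_split /=; congr (_ * _).
by apply: eq_bigr => i _; rewrite !ffunE !exprD mulrACA.
Qed.

Definition mon_sum (f : R) := exists2 l : seq (R * expo * expo),
  {in l, forall s, C s.1.1} & f = \sum_(s <- l) mon s.

Lemma mon_sumD f g : mon_sum f -> mon_sum g -> mon_sum (f + g).
Proof.
move=> [l Cl ->] [l' Cl' ->]; exists (l ++ l'); last by rewrite big_cat.
by move=> s; rewrite mem_cat => /orP[/Cl|/Cl'].
Qed.

Lemma mon_sumM f g : mon_sum f -> mon_sum g -> mon_sum (f * g).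
Proof.
move=> [l Cl ->] [l' Cl' ->]; exists [seq mon_mul s t | s <- l, t <- l'].
  by move=> u /allpairsP[[s t] [/Cl Cs /Cl' Ct ->]]; apply: CM.
rewrite big_allpairs_dep mulr_suml; apply: eq_bigr => s _.
by rewrite mulr_sumr; apply: eq_bigr => t _; rewrite monM.
Qed.

Lemma mon_sum_mon (u : R) (a b : expo) : C u -> mon_sum (mon (u, a, b)).
Proof.
move=> Cu; exists [:: (u, a, b)]; last by rewrite big_seq1.
by move=> s; rewrite inE => /eqP->.
Qed.

Lemma mon_sum_scalar f : C f -> mon_sum f.
Proof.
move=> Cf; have := mon_sum_mon [ffun=> 0%N] [ffun=> 0%N] Cf; rewrite /mon /=.
by rewrite big1 ?mulr1 // => i _; rewrite !ffunE !expr0 mulr1.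
Qed.

Lemma mon_sum_p i : mon_sum (p i).
Proof.
have := mon_sum_mon [ffun j => (j == i : nat)] [ffun=> 0%N] C1; rewrite /mon /=.
rewrite (bigD1 i) //= big1 => [|j ne]; last by rewrite !ffunE (negPf ne) mulr1.
by rewrite !ffunE eqxx mul1r !mulr1.
Qed.

Lemma mon_sum_q i : mon_sum (q i).
Proof.
have := mon_sum_mon [ffun=> 0%N] [ffun j => (j == i : nat)] C1; rewrite /mon /=.
rewrite (bigD1 i) //= big1 => [|j ne]; last by rewrite !ffunE (negPf ne) mulr1.
by rewrite !ffunE eqxx !mul1r mulr1.
Qed.

(* The weight of the monomial at vertex i vanishes, p_j being an entry of row
   j + 1 and column j, and q_j one of row j and column j + 1. *)
Definition balanced (s : R * expo * expo) i :=
  (\sum_j (((ordS j == i) : nat) * s.1.2 j + ((j == i) : nat) * s.2 j) ==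
   \sum_j (((j == i) : nat) * s.1.2 j + ((ordS j == i) : nat) * s.2 j))%N.

(** Each of the four indicator sums keeps a single index. The resulting equation says that the
    difference of the exponents of p and q is the same at [i] and at [ordS i]. *)
Lemma balancedE (s : R * expo * expo) i : balanced s (ordS i) =
  (s.1.2 i + s.2 (ordS i) == s.1.2 (ordS i) + s.2 i)%N.
Proof.
have pick (f : 'I_n.+1 -> nat) (g : 'I_n.+1 -> 'I_n.+1) l j : injective g -> g l = j ->
    (\sum_m ((g m == j) : nat) * f m = f l)%N.
  move=> gI <-; rewrite (bigD1 l) //= eqxx mul1n big1 ?addn0 // => m ne.
  by rewrite (inj_eq gI) (negPf ne).
rewrite /balanced !big_split /=; congr (_ == _); congr (_ + _)%N.
- by apply: pick => //; exact: ordS_inj.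
- exact: (pick _ id).
- exact: (pick _ id).
- by apply: pick => //; exact: ordS_inj.
Qed.

Variable t : R.
Hypotheses (pq : forall i, p i * q i = t) (Ct : C t).
Hypotheses (Cp : C (\prod_i p i)) (Cq : C (\prod_i q i)).
Lemma closed_exp f d : C f -> C (f ^+ d).
Proof.
by move=> Cf; elim: d => [|d IHd]; [exact: C1|rewrite exprS; apply: CM].
Qed.
(** The difference [a i - b i] is a constant d. If d is nonnegative, the monomial is the d-th power
    of [\prod_i p i] times powers of [p i * q i = t]; otherwise p and q exchange roles. *)
Lemma balanced_mon (s : R * expo * expo) : C s.1.1 -> (forall i, balanced s i) -> C (mon s).
Proof.
case: s => [[u a] b] /= Cu bs; rewrite /mon /=; apply: CM => //.
pose d i := ((a i)%:Z - (b i)%:Z).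
have dE i : d i = d ord0.
  apply: ordS_const => {}i; rewrite /d; have := bs (ordS i); rewrite balancedE /=.
  by move=> /eqP; lia.
have Cpq (c : 'I_n.+1 -> nat) : C (\prod_i (p i * q i) ^+ c i).
  by apply: big_ind => // i _; rewrite pq; exact: closed_exp.
have [le|/ltnW le] := leqP (b ord0) (a ord0).
  rewrite (eq_bigr (fun i => p i ^+ (a ord0 - b ord0) * (p i * q i) ^+ b i)) => [|i _].
    by rewrite big_split /= prodrXl; apply: CM; [exact: closed_exp|exact: Cpq].
  have -> : a i = (a ord0 - b ord0 + b i)%N by have := dE i; rewrite /d; lia.
  by rewrite exprD exprMn -mulrA.
rewrite (eq_bigr (fun i => q i ^+ (b ord0 - a ord0) * (p i * q i) ^+ a i)) => [|i _].
  by rewrite big_split /= prodrXl; apply: CM; [exact: closed_exp|exact: Cpq].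
have -> : b i = (b ord0 - a ord0 + a i)%N by have := dE i; rewrite /d; lia.
by rewrite exprD exprMn mulrCA.
Qed.
End Monomials.

(** * Cyclic algebras on two commuting elements x and y, with 1 + xy inverted *)

Section CyclicAlgebra.
Variables (k : fieldType) (n : nat) (A : algType k) (e : 'I_n.+1 -> A) (x y v : A).
Hypothesis eM : forall i j, e i * e j = if i == j then e i else 0.
Hypothesis sum_e : \sum_i e i = 1.
Hypothesis xe : forall i, x * e i = e (ordS i) * x.
Hypothesis ye : forall i, y * e (ordS i) = e i * y.
Hypothesis xyC : x * y = y * x.
Hypothesis vU : v * (1 + x * y) = 1.
Hypothesis Uv : (1 + x * y) * v = 1.
Hypothesis gen : forall P : A -> Prop,
  (forall a b, P a -> P b -> P (a + b)) -> (forall a b, P a -> P b -> P (a * b)) ->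
  (forall c a, P a -> P (c *: a)) -> P x -> P y -> P v -> (forall i, P (e i)) ->
  forall a, P a.

Local Notation U := (1 + x * y).
Local Notation kXY := {poly {poly k}}.

Lemma U_x : U * x = x * U.
Proof. by rewrite mulrDl mulrDr mul1r mulr1 -mulrA -xyC. Qed.
Lemma U_y : U * y = y * U.
Proof. by rewrite mulrDl mulrDr mul1r mulr1 mulrA -xyC. Qed.
Lemma U_e i : U * e i = e i * U.
Proof.
rewrite mulrDl mulrDr mul1r mulr1 -[i]ord_predK -mulrA ye mulrA xe -mulrA //.
Qed.
Lemma U_exp_eq0 M a : U ^+ M * a = 0 -> a = 0.
Proof.
move=> Ua; rewrite -[a]mul1r -(expr1n _ M) -vU exprMn_comm ?(Uv, vU) //.
  by rewrite -mulrA Ua mulr0.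
by rewrite /GRing.comm Uv vU.
Qed.

Fact comm_horner_y : commr_rmorph (horner_alg y) x.
Proof.
pose f : {rmorphism {poly k} -> A} := horner_alg y.
have fX : f 'X = y by exact: horner_algX.
have fC c : f c%:P = c%:A by exact: horner_algC.
move=> p; rewrite -[horner_alg y p]/(f p) /GRing.comm; move: f fX fC => f fX fC.
elim/poly_ind: p => [|p c IHp]; first by rewrite rmorph0 mulr0 mul0r.
rewrite rmorphD rmorphM /= fX fC mulrDr mulrDl mulr_algr mulr_algl.
by rewrite mulrA IHp -!mulrA xyC.
Qed.
(** Evaluation at a commuting pair in a noncommutative ring: the outer variable goes to x, the inner
    one to y. *)
Definition theta : kXY -> A := horner_morph comm_horner_y.
HB.instance Definition _ := GRing.RMorphism.on theta.

Lemma thetaX : theta 'X = x. Proof. exact: horner_morphX. Qed.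
Lemma thetaY : theta 'X%:P = y.
Proof. by rewrite /theta horner_morphC; exact: horner_algX. Qed.
Lemma thetaC c : theta c%:P%:P = c%:A.
Proof. by rewrite /theta horner_morphC; exact: horner_algC. Qed.

(** * Normal forms read off from a weighted shift representation *)

Section Model.
Variables (F : comAlgType k) (iota : {rmorphism kXY -> F}).
Hypothesis iota_inj : injective iota.
Hypothesis iotaC : forall c, iota c%:P%:P = c%:A.
Variable r : rep e F.
Hypothesis rx : forall i j, r x i j = if i == ordS j then iota 'X else 0.
Hypothesis ry : forall i j, r y i j = if j == ordS i then iota 'X%:P else 0.

(* Up to powers of 1 + xy the (i, j) entry of r a is the polynomial in x and y
   that represents e_i a e_j. *)
Definition normal_form (a : A) (E : 'M[kXY]_n.+1) := r a = map_mx iota E /\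
  forall i j, e i * a * e j = e i * theta (E i j) * e j.
Definition has_nf (a : A) := exists E, normal_form a E.

Lemma has_nf1 : has_nf 1.
Proof.
exists 1%:M; split=> [|i j]; first by rewrite rep1 map_mx1.
rewrite mulr1 mxE eM; case: eqP => [->|ne]; first by rewrite rmorph1 mulr1 eM eqxx.
by rewrite rmorph0 mulr0 mul0r.
Qed.

Lemma has_nfD a b : has_nf a -> has_nf b -> has_nf (a + b).
Proof.
move=> [E [ra Ea]] [E' [rb Eb]]; exists (E + E'); split=> [|i j].
  by rewrite repD ra rb map_mxD.
by rewrite mxE rmorphD !mulrDr !mulrDl Ea Eb.
Qed.

Lemma has_nfZ c a : has_nf a -> has_nf (c *: a).
Proof.
move=> [E [ra Ea]]; exists (c%:P%:P *: E); split=> [|i j].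
  by rewrite repZ ra map_mxZ iotaC.
by rewrite mxE rmorphM /= thetaC mulr_algl -!scalerAr -!scalerAl Ea.
Qed.

(** Since [e (ordS i) * x = x * e i], multiplication by x moves the rows of the matrix one step and
    scales them by X. *)
Lemma has_nf_x a : has_nf a -> has_nf (x * a).
Proof.
move=> [E [ra Ea]]; exists (\matrix_(i, j) ('X * E (ord_pred i) j)); split=> [|i j].
  apply/matrixP => i j; rewrite repM !mxE (bigD1 (ord_pred i)) //= rx ord_predK eqxx.
  rewrite big1 ?addr0 => [|l ne]; first by rewrite rmorphM ra mxE.
  by rewrite rx -(can2_eq (@ord_predK _) (@ordSK _)) eq_sym (negPf ne) mul0r.
rewrite mxE rmorphM /= thetaX -{1 2}[i]ord_predK !mulrA -xe -2!(mulrA x) Ea.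
by rewrite !mulrA xe.
Qed.

Lemma has_nf_y a : has_nf a -> has_nf (y * a).
Proof.
move=> [E [ra Ea]]; exists (\matrix_(i, j) ('X%:P * E (ordS i) j)); split=> [|i j].
  apply/matrixP => i j; rewrite repM !mxE (bigD1 (ordS i)) //= ry eqxx.
  rewrite big1 ?addr0 => [|l ne]; first by rewrite rmorphM ra mxE.
  by rewrite ry (negPf ne) mul0r.
rewrite mxE rmorphM /= thetaY !mulrA -ye -2!(mulrA y) Ea.
by rewrite !mulrA ye.
Qed.

Lemma has_nf_e l a : has_nf a -> has_nf (e l * a).
Proof.
move=> [E [ra Ea]]; exists (\matrix_(i, j) (if i == l then E i j else 0)).
split=> [|i j].
  apply/matrixP => i j; rewrite repM repP ra !mxE (bigD1 l) //= !mxE eqxx andbT.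
  rewrite big1 ?addr0 => [|s ne]; last by rewrite mxE (negPf ne) andbF mul0r.
  by case: eqP => [->|_]; rewrite ?mul1r // mul0r rmorph0.
rewrite mxE mulrA eM; case: eqP => [->|_]; first exact: Ea.
by rewrite rmorph0 mulr0 !mul0r.
Qed.

Lemma has_nf_U a : has_nf a -> has_nf (U * a).
Proof.
by move=> na; rewrite mulrDl mul1r -mulrA; apply/has_nfD/has_nf_x/has_nf_y.
Qed.

Lemma has_nf_UX M a : has_nf a -> has_nf (U ^+ M * a).
Proof.
move=> na; elim: M => [|M IHM]; first by rewrite mul1r.
by rewrite exprS -mulrA; apply: has_nf_U.
Qed.

(** The powers of U only serve to clear the factors v: every other generator commutes with U and
    preserves normal forms. *)
Lemma has_nfP a : exists M, has_nf (U ^+ M * a).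
Proof.
(* Normal forms are known to be stable only under left multiplication by generators, so the
   induction bears on left multiplication by g, a property closed under products. *)
pose P g := forall b, (exists M, has_nf (U ^+ M * b)) -> exists M, has_nf (U ^+ M * (g * b)).
have UXC M g b : U * g = g * U -> U ^+ M * (g * b) = g * (U ^+ M * b).
  move=> gU; rewrite !mulrA; congr (_ * _); exact/esym/commrX/esym.
suff: P a.
  by move=> /(_ 1)[|M]; [exists 0%N; rewrite mul1r; exact: has_nf1|rewrite mulr1; exists M].
apply: (gen (P := P)) => {a} [a b Pa Pb c nc|a b Pa Pb c nc|c a Pa b nb||||i].
- have [[M nM] [M' nM']] := (Pa c nc, Pb c nc); exists (M + M')%N.
  rewrite mulrDl mulrDr; apply: has_nfD; last by rewrite exprD -mulrA; apply: has_nf_UX.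
  by rewrite addnC exprD -mulrA; apply: has_nf_UX.
- by rewrite -mulrA; exact/Pa/Pb.
- have [M nM] := Pa b nb; exists M.
  by rewrite -scalerAl -scalerAr; apply: has_nfZ.
- by move=> b [M nM]; exists M; rewrite (UXC _ _ _ U_x); apply: has_nf_x.
- by move=> b [M nM]; exists M; rewrite (UXC _ _ _ U_y); apply: has_nf_y.
- by move=> b [M nM]; exists M.+1; rewrite exprSr -mulrA [U * _]mulrA Uv mul1r.
- by move=> b [M nM]; exists M; rewrite (UXC _ _ _ (U_e i)); apply: has_nf_e.
Qed.

Lemma sum_ee a : a = \sum_i \sum_j e i * a * e j.
Proof.
rewrite -{1}[a]mul1r -{1}[1 * a]mulr1 -sum_e mulr_suml mulr_suml.
by apply: eq_bigr => i _; rewrite mulr_sumr.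
Qed.

(** The entries of [U ^+ M * a] in the model are the polynomials of its normal form, seen through
    the injective [iota]. If they vanish, so do all corners of [U ^+ M * a], and U is invertible. *)
Lemma model_inj a : r a = 0 -> a = 0.
Proof.
move=> ra; have [M [E [rE Ea]]] := has_nfP a; apply: (@U_exp_eq0 M).
rewrite [LHS]sum_ee big1 // => i _; rewrite big1 // => j _; rewrite Ea.
have /matrixP/(_ i j) := rE; rewrite repM ra mulmx0 !mxE -(rmorph0 iota).
by move/iota_inj <-; rewrite rmorph0 mulr0 mul0r.
Qed.

(** Commutation with the idempotents makes the matrix of polynomials diagonal, and commutation with
    x makes its diagonal constant. *)
Lemma central_nf z : (forall a, z * a = a * z) ->
  exists M D, U ^+ M * z = \sum_i e i * theta D * e i.
Proof.
move=> zC; have [M [E [rE Ea]]] := has_nfP z; exists M.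
set a := U ^+ M * z in rE Ea *.
have aC b : (b = x) \/ (exists i, b = e i) -> a * b = b * a.
  rewrite /a => Cb; rewrite -mulrA zC !mulrA; congr (_ * _).
  by apply/esym/commrX; case: Cb => [->|[i ->]]; [exact/esym/U_x|exact/esym/U_e].
clearbody a.
have E0 i j : i != j -> E i j = 0.
  move=> ij; apply: iota_inj; rewrite rmorph0.
  have /(congr1 r) := aC (e i) (or_intror (ex_intro _ i erefl)).
  rewrite !repM repP rE => /matrixP/(_ i j).
  rewrite !mxE (bigD1 i) //= big1 => [|l ne]; last by rewrite !mxE (negPf ne) mulr0.
  rewrite (bigD1 i) //= big1 => [|l ne]; last by rewrite !mxE (negPf ne) andbF mul0r.
  by rewrite !mxE eqxx [j == i]eq_sym (negPf ij) mulr0 !addr0 mul1r => <-.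
have Econst i : E (ordS i) (ordS i) = E i i.
  have /(congr1 r) := aC x (or_introl erefl).
  (* This entry of ax = xa compares two consecutive diagonal polynomials, each multiplied by X,
     which cancels because polynomials form a domain. *)
  rewrite !repM rE => /matrixP/(_ (ordS i) i).
  rewrite !mxE (bigD1 (ordS i)) //= big1 => [|l ne]; last first.
    by rewrite mxE E0 ?rmorph0 ?mul0r // eq_sym.
  rewrite (bigD1 i) //= big1 => [|l ne]; last by rewrite mxE E0 // rmorph0 mulr0.
  rewrite !mxE rx eqxx !addr0 -!(rmorphM iota) => /iota_inj; rewrite mulrC.
  by apply: mulfI; rewrite polyX_eq0.
exists (E ord0 ord0); rewrite [LHS]sum_ee; apply: eq_bigr => i _.
rewrite (bigD1 i) //= big1 => [|j ne]; last first.
  by rewrite Ea E0 1?eq_sym // rmorph0 mulr0 mul0r.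
by rewrite addr0 Ea (ordS_const (f := fun i => E i i)).
Qed.
End Model.

(** The generator v is the inverse of U, so what commutes with x and y commutes with v too. *)
Lemma central_gen c : c * x = x * c -> c * y = y * c ->
  (forall i, c * e i = e i * c) -> forall a, c * a = a * c.
Proof.
move=> cx cy ce; apply: gen => // [a b ca cb|a b ca cb|d a ca|].
- by rewrite mulrDl mulrDr ca cb.
- by rewrite mulrA ca -mulrA cb mulrA.
- by rewrite -scalerAl -scalerAr ca.
have cU : c * U = U * c by rewrite mulrDl mulrDr mul1r mulr1 mulrA cx -mulrA cy mulrA.
by rewrite -[LHS]mul1r -vU -!mulrA [_ * (c * v)]mulrA -cU -mulrA Uv mulr1.
Qed.

Lemma xX_e d i : x ^+ d * e i = e (iter d (@ordS _) i) * x ^+ d.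
Proof.
elim: d => [|d IHd]; first by rewrite mul1r mulr1.
by rewrite exprS -mulrA IHd mulrA xe -mulrA.
Qed.

Lemma yX_e d i : y ^+ d * e (iter d (@ordS _) i) = e i * y ^+ d.
Proof.
elim: d => [|d IHd]; first by rewrite mul1r mulr1.
by rewrite exprSr -mulrA iterS ye mulrA IHd mulrA.
Qed.

Lemma iter_ordS_id i : iter n.+1 (@ordS n.+1) i = i.
Proof. by apply/eqP; rewrite iter_ordS_eq. Qed.

(** A shift by n + 1 steps brings every vertex back to itself, so this power commutes with the
    idempotents. *)
Lemma xN_central a : x ^+ n.+1 * a = a * x ^+ n.+1.
Proof.
apply: central_gen => [||i]; last by rewrite xX_e iter_ordS_id.
- by rewrite -exprSr exprS.
- by apply/esym/commrX; rewrite /GRing.comm xyC.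
Qed.

Lemma yN_central a : y ^+ n.+1 * a = a * y ^+ n.+1.
Proof.
apply: central_gen => [||i]; last by rewrite -{1}[i]iter_ordS_id yX_e.
- by apply/esym/commrX; rewrite /GRing.comm xyC.
- by rewrite -exprSr exprS.
Qed.

Lemma xy_central a : x * y * a = a * (x * y).
Proof.
apply: central_gen => [||i]; first by rewrite -mulrA -xyC.
- by rewrite xyC -mulrA -xyC.
- by have := U_e i; rewrite mulrDl mulrDr mul1r mulr1 => /addrI.
Qed.

Lemma v_central a : v * a = a * v.
Proof.
rewrite -[LHS]mulr1 -Uv mulrA -(mulrA v) mulrDr mulr1 -xy_central.
by rewrite -{1}[a]mul1r -mulrDl mulrA vU mul1r.
Qed.

(** * Matrix entries in an arbitrary representation *)

Section Entries.
Variables (C : comAlgType k) (r : rep e C).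
Let p i := r x (ordS i) i.
Let q i := r y i (ordS i).

Lemma rep_eM l a i j : r (e l * a) i j = if i == l then r a l j else 0.
Proof.
rewrite repM repP !mxE (bigD1 l) //= big1 => [|s ne]; last first.
  by rewrite mxE (negPf ne) andbF mul0r.
by rewrite mxE eqxx andbT addr0; case: eqP => _; rewrite ?mul1r ?mul0r.
Qed.

Lemma rep_Me l a i j : r (a * e l) i j = if j == l then r a i l else 0.
Proof.
rewrite repM repP !mxE (bigD1 l) //= big1 => [|s ne]; last first.
  by rewrite mxE (negPf ne) mulr0.
by rewrite mxE eqxx addr0; case: eqP => _; rewrite ?mulr1 ?mulr0.
Qed.

(** The idempotents act as coordinate projections, so [xe] confines x to these positions. *)
Lemma rep_x i j : r x i j = if i == ordS j then p j else 0.
Proof.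
have := congr1 (fun a => r a i j) (xe j).
by rewrite rep_Me rep_eM eqxx.
Qed.

Lemma rep_y i j : r y i j = if j == ordS i then q i else 0.
Proof.
have := congr1 (fun a => r a i j) (ye i).
by rewrite rep_Me rep_eM eqxx => <-.
Qed.

Lemma rep_xX d i j : r (x ^+ d) i j =
  if i == iter d (@ordS _) j then \prod_(l < d) p (iter l (@ordS _) j) else 0.
Proof.
elim: d i => [|d IHd] i.
  by rewrite expr0 rep1 mxE big_ord0; case: eqP.
rewrite exprS repM !mxE (bigD1 (iter d (@ordS _) j)) //= big1 => [|l ne]; last first.
  by rewrite IHd (negPf ne) mulr0.
rewrite IHd eqxx rep_x addr0 big_ord_recr /=.
by case: eqP => _; rewrite ?mul0r // mulrC.
Qed.

Lemma rep_yX d i j : r (y ^+ d) i j =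
  if j == iter d (@ordS _) i then \prod_(l < d) q (iter l (@ordS _) i) else 0.
Proof.
elim: d j => [|d IHd] j.
  by rewrite expr0 rep1 mxE big_ord0 eq_sym; case: eqP.
rewrite exprSr repM !mxE (bigD1 (iter d (@ordS _) i)) //= big1 => [|l ne]; last first.
  by rewrite IHd (negPf ne) mul0r.
rewrite IHd eqxx rep_y addr0 big_ord_recr /=.
by case: eqP => _; rewrite ?mulr0.
Qed.

Lemma rep_xN : r (x ^+ n.+1) = (\prod_i p i)%:M.
Proof.
apply/matrixP => i j; rewrite rep_xX iter_ordS_id prod_iter_ordS mxE.
by case: eqP.
Qed.

Lemma rep_yN : r (y ^+ n.+1) = (\prod_i q i)%:M.
Proof.
apply/matrixP => i j; rewrite rep_yX iter_ordS_id prod_iter_ordS mxE.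
by rewrite eq_sym; case: eqP.
Qed.

Lemma rep_yx i j : r (y * x) i j = if i == j then p i * q i else 0.
Proof.
rewrite repM !mxE (bigD1 (ordS i)) //= big1 => [|l ne]; last first.
  by rewrite rep_y (negPf ne) mul0r.
rewrite rep_x rep_y eqxx addr0 (inj_eq (@ordS_inj _)).
by case: eqP => [->|_]; rewrite ?mulr0 // mulrC.
Qed.

(** The diagonal entry of xy = yx at [ordS i] equates the products at [i] and [ordS i]. *)
Lemma rep_pq i : p i * q i = p ord0 * q ord0.
Proof.
apply: (ordS_const (f := fun i => p i * q i)) => {}i.
have := congr1 (fun a => r a (ordS i) (ordS i)) xyC.
rewrite rep_yx eqxx => <-; rewrite repM !mxE (bigD1 i) //= big1 => [|l ne]; last first.
  by rewrite rep_x (inj_eq (@ordS_inj _)) eq_sym (negPf ne) mul0r.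
by rewrite addr0.
Qed.

Lemma rep_xy : r (x * y) = (p ord0 * q ord0)%:M.
Proof.
apply/matrixP => i j; rewrite xyC rep_yx mxE.
by case: eqP => // _; rewrite rep_pq.
Qed.

(** 1 + xy acts by a scalar, and the inverse of an invertible scalar matrix is scalar. *)
Lemma rep_v : r v = (r v ord0 ord0)%:M.
Proof.
have := congr1 (fun a => r a) vU.
rewrite repM repD rep1 rep_xy mulmxDr mulmx1 mul_mx_scalar => E.
have vt i j : r v i j * (1 + p ord0 * q ord0) = (i == j)%:R.
  by have /matrixP/(_ i j) := E; rewrite !mxE mulrDr mulr1 [_ * (p _ * _)]mulrC.
have v00 := vt ord0 ord0; rewrite eqxx in v00.
apply/matrixP => i j; rewrite mxE -[LHS]mulr1 -[1]v00 mulrCA vt.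
by case: eqP => _; rewrite ?mulr1 ?mulr0.
Qed.
End Entries.

(** * The center and the invariant functions *)

Section Invariants.
Variable pr : ~ ideal_gen (rep_rel e) 1.
Local Notation B := (rep_ring pr).
(* A variable standing for the universal representation, which simplification
   would otherwise unfold. *)
Variable ev : rep e B.
Hypothesis evE : forall a, ev a = rep_ev pr a.
Local Notation p i := (ev x (ordS i) i).
Local Notation q i := (ev y i (ordS i)).

(** The image of the center. That every central element acts by a scalar is established only in
    [ev_central], so it is demanded here. *)
Definition from_center (f : B) := exists2 z, (forall a, z * a = a * z) & ev z = f%:M.

Lemma from_centerC c : from_center c%:A.
Proof.
exists c%:A; first by move=> a; rewrite mulr_algl mulr_algr.
by rewrite repZ rep1 scale_scalar_mx mulr1.
Qed.

Lemma from_centerD f g : from_center f -> from_center g -> from_center (f + g).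
Proof.
move=> [z zC ez] [w wC ew]; exists (z + w); last first.
  by rewrite repD ez ew; exact/esym/(raddfD (@scalar_mx B n.+1)).
by move=> a; rewrite mulrDl mulrDr zC wC.
Qed.

Lemma from_centerM f g : from_center f -> from_center g -> from_center (f * g).
Proof.
move=> [z zC ez] [w wC ew]; exists (z * w); last by rewrite repM ez ew -scalar_mxM.
by move=> a; rewrite -mulrA wC mulrA zC mulrA.
Qed.

Lemma from_center0 : from_center 0.
Proof. by rewrite -(scale0r 1); exact: from_centerC. Qed.
Lemma from_center1 : from_center 1.
Proof. by rewrite -(scale1r 1); exact: from_centerC. Qed.

Lemma from_centerX f d : from_center f -> from_center (f ^+ d).
Proof.
move=> Cf; elim: d => [|d IHd]; first exact: from_center1.
by rewrite exprS; apply: from_centerM.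
Qed.

Lemma from_center_sum (I : Type) (l : seq I) (P : pred I) (f : I -> B) :
  (forall s, P s -> from_center (f s)) -> from_center (\sum_(s <- l | P s) f s).
Proof. by move=> Cf; apply: big_ind => //; [exact: from_center0|exact: from_centerD]. Qed.

Lemma from_center_pq : from_center (p ord0 * q ord0).
Proof. by exists (x * y); [exact: xy_central|exact: rep_xy]. Qed.
Lemma from_center_v : from_center (ev v ord0 ord0).
Proof. by exists v; [exact: v_central|exact: rep_v]. Qed.
Lemma from_center_p : from_center (\prod_i p i).
Proof. by exists (x ^+ n.+1); [exact: xN_central|exact: rep_xN]. Qed.
Lemma from_center_q : from_center (\prod_i q i).
Proof. by exists (y ^+ n.+1); [exact: yN_central|exact: rep_yN]. Qed.

Lemma theta_monomial c a b : theta (c%:P%:P * 'X^a * 'X%:P ^+ b) =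
  c *: (x ^+ a * y ^+ b).
Proof. by rewrite !rmorphM !rmorphXn /= thetaC thetaX thetaY -mulrA mulr_algl. Qed.

(** Only the diagonal is constrained, because the normal form [\sum_i e i * theta D * e i] of a
    central element cuts off all other entries. *)
Definition central_diag a := exists2 s, from_center s & forall i, ev a i i = s.

(** [x ^+ d] moves every vertex unless n + 1 divides d, and then it is a power of the central
    [x ^+ n.+1]. *)
Lemma central_diag_x d : central_diag (x ^+ d).
Proof.
have [/dvdnP[c ->]|nd] := boolP (n.+1 %| d)%N; last first.
  exists 0; first exact: from_center0.
  by move=> i; rewrite rep_xX eq_sym iter_ordS_eq (negPf nd).
exists ((\prod_i p i) ^+ c); first exact/from_centerX/from_center_p.
by move=> i; rewrite mulnC exprM repX rep_xN -rmorphXn mxE eqxx.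
Qed.

Lemma central_diag_y d : central_diag (y ^+ d).
Proof.
have [/dvdnP[c ->]|nd] := boolP (n.+1 %| d)%N; last first.
  exists 0; first exact: from_center0.
  by move=> i; rewrite rep_yX eq_sym iter_ordS_eq (negPf nd).
exists ((\prod_i q i) ^+ c); first exact/from_centerX/from_center_q.
by move=> i; rewrite mulnC exprM repX rep_yN -rmorphXn mxE eqxx.
Qed.

Lemma central_diagM z f a : from_center f -> ev z = f%:M -> central_diag a ->
  central_diag (z * a).
Proof.
move=> Cf ez [s Cs Ds]; exists (f * s); first exact: from_centerM.
by move=> i; rewrite repM ez mul_scalar_mx mxE Ds.
Qed.

(** In a monomial x^a y^b the smaller exponent is split off as a power of the central element xy,
    leaving a pure power of x or of y. *)
Lemma central_diag_theta D : central_diag (theta D).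
Proof.
elim/poly2_ind: D => [|D D' [s Cs Ds] [s' Cs' Ds']|c a b].
- exists 0; first exact: from_center0.
  by move=> i; rewrite rmorph0 rep0 mxE.
- exists (s + s'); first exact: from_centerD.
  by move=> i; rewrite rmorphD repD mxE Ds Ds'.
rewrite theta_monomial -mulr_algl; apply: central_diagM (from_centerC c) _ _.
  by rewrite repZ rep1 scale_scalar_mx mulr1.
have xyX d : x ^+ d * y ^+ d = (x * y) ^+ d by rewrite exprMn_comm.
have ct d : ev ((x * y) ^+ d) = ((p ord0 * q ord0) ^+ d)%:M.
  by rewrite repX rep_xy -rmorphXn.
have Ct d : from_center ((p ord0 * q ord0) ^+ d) by exact/from_centerX/from_center_pq.
have [ba|/ltnW ab] := leqP b a.
  rewrite -(subnK ba) exprD -mulrA xyX.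
  rewrite (commrX _ (esym (xy_central _))).
  exact: central_diagM (Ct b) (ct b) (central_diag_x _).
rewrite -(subnKC ab) exprD mulrA xyX.
exact: central_diagM (Ct a) (ct a) (central_diag_y _).
Qed.

Variables (F : comAlgType k) (iota : {rmorphism kXY -> F}).
Hypothesis iota_inj : injective iota.
Hypothesis iotaC : forall c, iota c%:P%:P = c%:A.
Variable r : rep e F.
Hypothesis rx : forall i j, r x i j = if i == ordS j then iota 'X else 0.
Hypothesis ry : forall i j, r y i j = if j == ordS i then iota 'X%:P else 0.

(** By [central_nf] and [central_diag_theta] the element [U ^+ M * z] acts by a scalar; multiplying
    by [v ^+ M], which also acts by one, recovers z. *)
Lemma ev_central z : (forall a, z * a = a * z) -> ev z = (ev z ord0 ord0)%:M.
Proof.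
move=> zC; have [M [D eD]] := central_nf iota_inj iotaC rx ry zC.
have [s _ Ds] := central_diag_theta D.
have eUz : ev (U ^+ M * z) = s%:M.
  apply/matrixP => i j; rewrite eD rep_sum summxE (bigD1 j) // big1 => [|l ne].
    by rewrite [LHS]addr0 rep_Me eqxx rep_eM Ds mxE; case: eqP.
  by rewrite rep_Me eq_sym (negPf ne).
have -> : z = v ^+ M * (U ^+ M * z).
  by rewrite mulrA -exprMn_comm ?vU ?expr1n ?mul1r // /GRing.comm vU Uv.
rewrite repM eUz repX rep_v -rmorphXn -scalar_mxM; congr (_%:M).
by rewrite mxE eqxx.
Qed.

(** The model is a specialization of the universal representation and is already injective. *)
Lemma ev_inj a : ev a = 0 -> a = 0.
Proof.
move=> ea; apply: (model_inj iota_inj iotaC rx ry).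
by rewrite -(rep_at_ev pr r) -evE ea map_mx0.
Qed.

Let p_ i := p i.
Let q_ i := q i.
Local Notation expo := {ffun 'I_n.+1 -> nat}.
Local Notation mon := (mon p_ q_).
Local Notation mon_sum := (mon_sum p_ q_ from_center).
Let mon_sumC f : from_center f -> mon_sum f.
Proof. exact: mon_sum_scalar. Qed.

(** Induction on the generators of A. The entry of v is treated as a coefficient, since it is the
    scalar of a central element. *)
Lemma mon_sum_ev a i j : mon_sum (ev a i j).
Proof.
have mon0 : mon_sum 0 by exact/mon_sumC/from_center0.
have mon1 : mon_sum 1 by exact/mon_sumC/from_center1.
move: i j; move: a; apply: gen => [a b Ma Mb|a b Ma Mb|c a Ma||||l] i j.
- by rewrite repD mxE; apply: mon_sumD.
- rewrite repM mxE; apply: big_ind => // [|l _]; first exact: mon_sumD.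
  by apply: mon_sumM => //; exact: from_centerM.
- by rewrite repZ mxE; apply: mon_sumM => //; [exact: from_centerM|exact/mon_sumC/from_centerC].
- by rewrite rep_x; case: ifP => _ //; exact: (mon_sum_p p_ q_ from_center1).
- by rewrite rep_y; case: ifP => _ //; exact: (mon_sum_q p_ q_ from_center1).
- rewrite rep_v mxE; case: eqP => _ //; rewrite mulr1n.
  exact/mon_sumC/from_center_v.
- by rewrite repP mxE; case: andb.
Qed.

Lemma mon_sum_all f : mon_sum f.
Proof.
have [g <-] := quot_piP f; pose P g := mon_sum (quot_pi pr g : B).
apply: (poly_alg_ind (P := P)) => {f g} [f g Pf Pg|f g Pf Pg|c|[a [i j]]]; rewrite /P.
- by have -> : quot_pi pr (f + g) = quot_pi pr f + quot_pi pr g :> B;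
    [exact: rmorphD|exact: mon_sumD].
- have -> : quot_pi pr (f * g) = quot_pi pr f * quot_pi pr g :> B by exact: rmorphM.
  exact: (mon_sumM from_centerM).
- have -> : quot_pi pr c%:A = c%:A :> B by exact: rmorph_alg.
  exact/mon_sumC/from_centerC.
- by have := mon_sum_ev a i j; rewrite evE mxE.
Qed.

Lemma from_center_weight i f : from_center f -> has_weight i 0 0 f.
Proof.
move=> [z _ ez]; have := @has_weight_diag _ _ _ _ pr i z ord0.
by rewrite -evE ez mxE eqxx.
Qed.

Lemma invariant_balanced f : f \in gl_invariant (pr := pr) ->
  exists2 l : seq (B * expo * expo),
  {in l, forall s, from_center s.1.1 /\ forall i, balanced s i} & f = \sum_(s <- l) mon s.
Proof.
move=> invf; have [l Cl ef] := mon_sum_all f.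
(* The vertices are treated one at a time: invariance under the subgroup at [i] removes the
   monomials that are not balanced at [i]. *)
have step vs : f = \sum_(s <- [seq s <- l | all (balanced s) vs]) mon s.
  elim: vs => [|i vs IHvs]; first by rewrite filter_predT.
  have := invariant_weight0 (i := i) (l := [seq s <- l | all (balanced s) vs]) _ IHvs invf.
  (* The leading 0 is the weight of the coefficient, in the shape that [has_weightM] produces. *)
  pose a (s : B * expo * expo) :=
    (0 + \sum_j (((ordS j == i) : nat) * s.1.2 j + ((j == i) : nat) * s.2 j))%N.
  pose b (s : B * expo * expo) :=
    (0 + \sum_j (((j == i) : nat) * s.1.2 j + ((ordS j == i) : nat) * s.2 j))%N.
  move=> /(_ a b) -> => [|s].
    by rewrite -big_filter -filter_predI.
  rewrite mem_filter => /andP[_ /Cl Cs]; apply: has_weightM.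
    exact: from_center_weight.
  apply: has_weight_prod => j; apply: has_weightM; apply: has_weightX;
  by rewrite ?/p_ ?/q_ evE; exact: has_weight_ev.
exists [seq s <- l | all (balanced s) (enum 'I_n.+1)]; last exact: step.
move=> s; rewrite mem_filter => /andP[/allP bs /Cl Cs]; split=> // i.
by apply: bs; rewrite mem_enum.
Qed.

Lemma invariant_from_center f : f \in gl_invariant (pr := pr) -> from_center f.
Proof.
move=> /invariant_balanced[l Cl ->]; rewrite big_seq; apply: from_center_sum => s.
move=> /Cl[]; apply: (balanced_mon from_centerM from_center1 (t := p ord0 * q ord0)).
- by move=> i; exact: rep_pq.
- exact: from_center_pq.
- exact: from_center_p.
- exact: from_center_q.
Qed.

Lemma ev_center_iso : exists evZ : {lrmorphism alg_center A -> invariant_ring pr},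
  (forall z, rep_ev pr (sval z) = (sval (evZ z))%:M) /\ bijective evZ.
Proof.
(* As [ev (sval z)] is a scalar matrix by [ev_central], one diagonal entry determines it, and
   diagonal entries are invariant. *)
pose f (z : alg_center A) : invariant_ring pr :=
  Sub (rep_ev pr (sval z) ord0 ord0) (gl_invariant_diag pr (sval z) ord0).
have zC (z : alg_center A) a : sval z * a = a * sval z by have /asboolP := valP z.
have fE z : ev (sval z) = (sval (f z))%:M by rewrite ev_central //= evE.
have sI : injective (@scalar_mx B n.+1).
  by move=> a b /matrixP/(_ ord0 ord0); rewrite !mxE eqxx.
have fP z u : ev (sval z) = u%:M -> sval (f z) = u by rewrite fE => /sI.
have fB : zmod_morphism f.
  move=> z w; apply/val_inj/fP/(etrans (y := ev (sval z) - ev (sval w))).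
    exact: (raddfB ev).
  by rewrite !fE; exact: esym (raddfB (@scalar_mx B n.+1) _ _).
have fM : monoid_morphism f.
  split=> [|z w]; first by apply/val_inj/fP; exact: rep1.
  apply/val_inj/fP/(etrans (y := ev (sval z) *m ev (sval w))); first exact: repM.
  by rewrite !fE; exact: esym (scalar_mxM _ _ _).
have fZ : scalable f.
  move=> c z; apply/val_inj/fP/(etrans (y := c%:A *: ev (sval z))); first exact: repZ.
  by rewrite fE scale_scalar_mx mulr_algl.
pose fB' := GRing.isZmodMorphism.Build _ _ f fB.
pose fM' := GRing.isMonoidMorphism.Build _ _ f fM.
pose fZ' := GRing.isScalable.Build k _ _ *:%R f fZ.
pose g : {lrmorphism alg_center A -> invariant_ring pr} := HB.pack f fB' fM' fZ'.
exists g; split=> [z|]; first by rewrite -evE; exact: fE.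
have gS (u : invariant_ring pr) : exists z, g z == u.
  have [z zC' ez] := invariant_from_center (valP u).
  have Cz : z \in alg_central (A := A) by apply/asboolP.
  exists (Sub z Cz); apply/eqP/val_inj/sI; rewrite -[LHS]fE; exact: ez.
have gI : injective g.
  apply: raddf_inj => z gz; apply: val_inj; apply: ev_inj.
  by rewrite fE -[f z]/(g z) gz; exact: raddf0.
by exists (fun u => xchoose (gS u)) => [z|u]; [apply: gI|]; apply/eqP/(xchooseP (gS _)).
Qed.
End Invariants.
End CyclicAlgebra.

(** * Relations in the multiplicative preprojective algebra of a cycle *)

(** The element [c] travels along the product and absorbs the factors outside P. With [c] a vertex
    idempotent this localizes the relation rho = 1 at that vertex. *)
Lemma corner_prod (R : pzRingType) (I : Type) (P : pred I) (c : R) (f : I -> R) (l : seq I) :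
  (forall a, c * f a = f a * c) -> (forall a, ~~ P a -> c * f a = c) ->
  c * \prod_(a <- l) f a = c * \prod_(a <- l | P a) f a.
Proof.
move=> cf fP; elim: l => [|a l IHl]; first by rewrite !big_nil.
rewrite !big_cons; case: ifPn => [_|nP]; last by rewrite mulrA fP.
by rewrite mulrA cf -mulrA IHl mulrA -cf mulrA.
Qed.

Section Relations.
Variables (k : fieldType) (n : nat) (o : 'I_n.+1 -> bool) (A : algType k).
Local Notation dQ := (double_quiver (Atilde n o)).
Variables (e : 'I_n.+1 -> A) (al w wi : arrow dQ -> A).
Hypothesis eM : forall i j, e i * e j = if i == j then e i else 0.
Hypothesis sum_e : \sum_i e i = 1.
Hypothesis al_l : forall a : arrow dQ, e (target a) * al a = al a.
Hypothesis al_r : forall a : arrow dQ, al a * e (source a) = al a.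
Hypothesis wE : forall a : arrow dQ, w a = 1 + al a * al (star a).
Hypothesis wV : forall a : arrow dQ, wi a * w a = 1.
Hypothesis wVr : forall a : arrow dQ, w a * wi a = 1.
(** The factor of the arrow in rho; [Gi] is its inverse. *)
Let G (a : arrow dQ) := match a with inl _ => w a | inr _ => wi a end.
Let Gi (a : arrow dQ) := match a with inl _ => wi a | inr _ => w a end.
Variable l : seq (arrow dQ).
Hypothesis l_uniq : uniq l.
Hypothesis l_all : forall a, a \in l.
Hypothesis prodG : \prod_(a <- l) G a = 1.
Hypothesis gen_arrows : forall P : A -> Prop,
  (forall a b, P a -> P b -> P (a + b)) -> (forall a b, P a -> P b -> P (a * b)) ->
  (forall c a, P a -> P (c *: a)) -> (forall i, P (e i)) -> (forall a, P (al a)) ->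
  (forall a, P (wi a)) -> forall a, P a.

(** The arrows of the double between [i] and [ordS i], sorted by direction around the cycle rather
    than by membership in Q. *)
Definition fwd (i : 'I_n.+1) : arrow dQ := if o i then inl i else inr i.
Definition bwd (i : 'I_n.+1) : arrow dQ := if o i then inr i else inl i.

Lemma star_fwd i : star (fwd i) = bwd i. Proof. by rewrite /fwd /bwd; case: o. Qed.
Lemma star_bwd i : star (bwd i) = fwd i. Proof. by rewrite /fwd /bwd; case: o. Qed.
Lemma target_fwd i : target (fwd i) = ordS i :> 'I_n.+1.
Proof. by rewrite /fwd; case E: (o i); rewrite /= E. Qed.
Lemma source_fwd i : source (fwd i) = i :> 'I_n.+1.
Proof. by rewrite /fwd; case E: (o i); rewrite /= E. Qed.
Lemma target_bwd i : target (bwd i) = i :> 'I_n.+1.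
Proof. by rewrite /bwd; case E: (o i); rewrite /= E. Qed.
Lemma source_bwd i : source (bwd i) = ordS i :> 'I_n.+1.
Proof. by rewrite /bwd; case E: (o i); rewrite /= E. Qed.
Lemma fwd_or_bwd (a : arrow dQ) : exists i, a = fwd i \/ a = bwd i.
Proof.
by case: a => i; exists i; rewrite /fwd /bwd; case: (o i); [left|right|right|left].
Qed.
Lemma fwd_neq_bwd i j : (fwd i == bwd j) = false.
Proof.
rewrite /fwd /bwd; case Ei: (o i); case Ej: (o j) => //; apply/eqP => -[eij];
by rewrite eij Ej in Ei.
Qed.

Definition fwd_elt i := al (fwd i).
Definition bwd_elt i := if o i then al (bwd i) else - (wi (bwd i) * al (bwd i)).

Lemma G_Gi (a : arrow dQ) : G a * Gi a = 1. Proof. by case: a => i; rewrite /= ?wV ?wVr. Qed.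
Lemma Gi_G (a : arrow dQ) : Gi a * G a = 1. Proof. by case: a => i; rewrite /= ?wV ?wVr. Qed.

Lemma vtx_fwd_elt i : e (ordS i) * fwd_elt i = fwd_elt i.
Proof. by rewrite /fwd_elt -{1}target_fwd al_l. Qed.
Lemma fwd_elt_vtx i : fwd_elt i * e i = fwd_elt i.
Proof. by rewrite /fwd_elt -{2}(source_fwd i) al_r. Qed.

(** The product of an arrow with its reverse is a loop at the target, which each idempotent either
    fixes on both sides or kills on both sides. *)
Lemma vtx_w_comm (a : arrow dQ) i : e i * w a = w a * e i.
Proof.
have sr : al (star a) * e (target a) = al (star a).
  by rewrite -[RHS]al_r; congr (_ * e _); case: (a).
rewrite wE mulrDl mulrDr mul1r mulr1; congr (_ + _).
have [->|ne] := eqVneq i (target a); first by rewrite mulrA al_l -mulrA sr.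
by rewrite -{1}(al_l a) -sr !mulrA eM (negPf ne) -!mulrA eM eq_sym (negPf ne) mul0r !mulr0.
Qed.

Lemma vtx_wi_comm a i : e i * wi a = wi a * e i.
Proof.
by rewrite -[LHS]mul1r -(wV a) -!mulrA (mulrA (w a)) -vtx_w_comm -mulrA wVr mulr1.
Qed.
Lemma vtx_G_comm a i : e i * G a = G a * e i.
Proof. by case: a => j; rewrite /= ?vtx_w_comm ?vtx_wi_comm. Qed.
Lemma vtx_Gi_comm a i : e i * Gi a = Gi a * e i.
Proof. by case: a => j; rewrite /= ?vtx_w_comm ?vtx_wi_comm. Qed.

Lemma vtx_w_neq (a : arrow dQ) (i : 'I_n.+1) : i != target a -> e i * w a = e i.
Proof.
by move=> ne; rewrite wE mulrDr mulr1 mulrA -[al a]al_l mulrA eM (negPf ne) !mul0r addr0.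
Qed.
Lemma vtx_wi_neq (a : arrow dQ) (i : 'I_n.+1) : i != target a -> e i * wi a = e i.
Proof. by move=> ne; rewrite -{1}(vtx_w_neq ne) -mulrA wVr mulr1. Qed.
Lemma vtx_G_neq (a : arrow dQ) (i : 'I_n.+1) : i != target a -> e i * G a = e i.
Proof. by case: a => j ne; [apply: vtx_w_neq|apply: vtx_wi_neq]. Qed.
Lemma vtx_Gi_neq (a : arrow dQ) (i : 'I_n.+1) : i != target a -> e i * Gi a = e i.
Proof. by case: a => j ne; [apply: vtx_wi_neq|apply: vtx_w_neq]. Qed.

(** Exactly two arrows end at [j = ordS i], namely [fwd i] and [bwd j]. Multiplied by [e j], the
    relation rho = 1 loses all other factors and says that these two cancel at [j]. *)
Lemma vtx_G_rel i : e (ordS i) * G (fwd i) = e (ordS i) * Gi (bwd (ordS i)).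
Proof.
set j := ordS i; set a1 := fwd i; set a2 := bwd j.
have := congr1 (fun c => e j * c) prodG; rewrite mulr1.
rewrite (corner_prod (P := fun a : arrow dQ => j == target a)) => [|a|a]; last 2 first.
- exact: vtx_G_comm.
- exact: vtx_G_neq.
rewrite -big_filter; set l' := filter _ _.
have pl' : perm_eq l' [:: a1; a2].
  apply: uniq_perm => [||a]; rewrite ?filter_uniq //= ?inE ?fwd_neq_bwd //.
  rewrite mem_filter l_all andbT ?inE.
  have [m [->|->]] := fwd_or_bwd a.
    rewrite target_fwd /j (inj_eq (@ordS_inj _)) /a1 /a2 fwd_neq_bwd orbF.
    by apply/eqP/eqP => [->|/(congr1 (@source dQ))]; rewrite ?source_fwd.
  rewrite target_bwd /a1 /a2 [bwd m == _]eq_sym fwd_neq_bwd /=.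
  by apply/eqP/eqP => [->|/(congr1 (@target dQ))]; rewrite ?target_bwd.
(* The order on the arrows decides which factor comes first; both cases give the same relation
   because [e j] commutes with the factors. *)
have [->|->] : l' = [:: a1; a2] \/ l' = [:: a2; a1].
- case: l' pl' => [|b [|c [|d l']]] pl'; have := perm_size pl' => //= _.
  have := perm_mem pl' b; rewrite !inE eqxx => /esym/orP[]/eqP eb; move: pl'; rewrite eb.
    by rewrite perm_cons => /perm_mem/(_ c); rewrite !inE eqxx => /esym/eqP->; left.
  rewrite perm_sym (perm_catC [:: a1] [:: a2]) perm_sym perm_cons => /perm_mem/(_ c).
  by rewrite !inE eqxx => /esym/eqP->; right.
- rewrite !big_cons big_nil mulr1 => /(congr1 (fun c => c * Gi a2)).
  by rewrite -!mulrA G_Gi mulr1.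
rewrite !big_cons big_nil mulr1 => E; have := congr1 (fun c => Gi a2 * c) E.
by rewrite /= (mulrA (Gi a2) (e j)) -vtx_Gi_comm -mulrA (mulrA (Gi a2)) Gi_G mul1r.
Qed.

Lemma vtx_Gi_rel i : e (ordS i) * Gi (fwd i) = e (ordS i) * G (bwd (ordS i)).
Proof.
have := congr1 (fun c => Gi (fwd i) * (c * G (bwd (ordS i)))) (vtx_G_rel i).
rewrite /= (vtx_G_comm (fwd i)) -!mulrA Gi_G mulr1 (mulrA (Gi (fwd i)) (G (fwd i))) Gi_G mul1r.
by rewrite -vtx_Gi_comm.
Qed.

(** The identity (1 + ab)^-1 a = a (1 + ba)^-1, obtained by inverting in a (1 + ba) = (1 + ab) a. *)
Lemma wi_fwd_elt i : wi (fwd i) * al (fwd i) = al (fwd i) * wi (bwd i).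
Proof.
have xw : al (fwd i) * w (bwd i) = w (fwd i) * al (fwd i).
  by rewrite !wE star_fwd star_bwd mulrDr mulrDl mulr1 mul1r mulrA.
by rewrite -[LHS]mulr1 -(wVr (bwd i)) -!mulrA (mulrA (al _)) xw !mulrA wV mul1r.
Qed.

(** For a reversed arrow, with a = [al (fwd i)] and b = [al (bwd i)], the product on the right is
    -(1 + ab)^-1 ab = (1 + ab)^-1 - 1. So both orientations obey the same formula, which motivates
    the choice of [bwd_elt]. *)
Lemma G_fwd i : G (fwd i) = 1 + fwd_elt i * bwd_elt i.
Proof.
rewrite /fwd_elt /bwd_elt; case E: (o i).
  by rewrite -star_fwd -wE /fwd E.
have -> : G (fwd i) = wi (fwd i) by rewrite /fwd E.
rewrite mulrN mulrA -wi_fwd_elt -mulrA.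
have -> : al (fwd i) * al (bwd i) = w (fwd i) - 1 by rewrite wE star_fwd addrC addKr.
by rewrite mulrBr wV mulr1 opprB addrC subrK.
Qed.

Lemma Gi_bwd i : Gi (bwd i) = 1 + bwd_elt i * fwd_elt i.
Proof.
rewrite /fwd_elt /bwd_elt; case E: (o i).
  by rewrite -star_bwd -wE /bwd E.
have -> : Gi (bwd i) = wi (bwd i) by rewrite /bwd E.
rewrite mulNr -mulrA.
have -> : al (bwd i) * al (fwd i) = w (bwd i) - 1 by rewrite wE star_bwd addrC addKr.
by rewrite mulrBr wV mulr1 opprB addrC subrK.
Qed.

Lemma vtx_bwd_elt i : e i * bwd_elt i = bwd_elt i.
Proof.
have eay : e i * al (bwd i) = al (bwd i) by rewrite -{1}(target_bwd i) al_l.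
by rewrite /bwd_elt; case: (o i) => //; rewrite mulrN mulrA vtx_wi_comm -mulrA eay.
Qed.
Lemma bwd_elt_vtx i : bwd_elt i * e (ordS i) = bwd_elt i.
Proof.
have aye : al (bwd i) * e (ordS i) = al (bwd i) by rewrite -(source_bwd i) al_r.
by rewrite /bwd_elt; case: (o i) => //; rewrite mulNr -mulrA aye.
Qed.

Lemma fwd_bwd_rel i : fwd_elt i * bwd_elt i = bwd_elt (ordS i) * fwd_elt (ordS i).
Proof.
have := vtx_G_rel i; rewrite G_fwd Gi_bwd !mulrDr !mulr1 => /addrI.
by rewrite !mulrA vtx_fwd_elt vtx_bwd_elt.
Qed.

Definition total_x := \sum_i fwd_elt i.
Definition total_y := \sum_i bwd_elt i.
(** The inverse of 1 + xy, assembled vertex by vertex: at [ordS i] the element 1 + xy restricts to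
    [G (fwd i)]. *)
Definition total_v := \sum_i e (ordS i) * Gi (fwd i).

Lemma total_x_vtx i : total_x * e i = fwd_elt i.
Proof.
rewrite mulr_suml (bigD1 i) //= fwd_elt_vtx big1 ?addr0 // => j ne.
by rewrite -fwd_elt_vtx -mulrA eM (negPf ne) mulr0.
Qed.
Lemma vtx_total_x i : e (ordS i) * total_x = fwd_elt i.
Proof.
rewrite mulr_sumr (bigD1 i) //= vtx_fwd_elt big1 ?addr0 // => j ne.
by rewrite -vtx_fwd_elt mulrA eM (inj_eq (@ordS_inj _)) eq_sym (negPf ne) mul0r.
Qed.
Lemma total_y_vtx i : total_y * e (ordS i) = bwd_elt i.
Proof.
rewrite mulr_suml (bigD1 i) //= bwd_elt_vtx big1 ?addr0 // => j ne.
by rewrite -bwd_elt_vtx -mulrA eM (inj_eq (@ordS_inj _)) (negPf ne) mulr0.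
Qed.
Lemma vtx_total_y i : e i * total_y = bwd_elt i.
Proof.
rewrite mulr_sumr (bigD1 i) //= vtx_bwd_elt big1 ?addr0 // => j ne.
by rewrite -vtx_bwd_elt mulrA eM eq_sym (negPf ne) mul0r.
Qed.

Lemma total_xe i : total_x * e i = e (ordS i) * total_x.
Proof. by rewrite total_x_vtx vtx_total_x. Qed.
Lemma total_ye i : total_y * e (ordS i) = e i * total_y.
Proof. by rewrite total_y_vtx vtx_total_y. Qed.

Lemma total_xyE : total_x * total_y = \sum_i fwd_elt i * bwd_elt i.
Proof.
rewrite {1}/total_x mulr_suml; apply: eq_bigr => i _.
by rewrite -{1}fwd_elt_vtx -mulrA vtx_total_y.
Qed.
Lemma total_xyC : total_x * total_y = total_y * total_x.
Proof.
rewrite total_xyE {1}/total_y mulr_suml [RHS](reindex_inj (@ordS_inj n.+1)).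
by apply: eq_bigr => i _; rewrite fwd_bwd_rel -[in RHS]bwd_elt_vtx -mulrA vtx_total_x.
Qed.

Lemma vtx_U i : e (ordS i) * (1 + total_x * total_y) = e (ordS i) * G (fwd i).
Proof.
rewrite G_fwd !mulrDr !mulr1 !mulrA vtx_total_x vtx_fwd_elt.
by rewrite -{1}fwd_elt_vtx -mulrA vtx_total_y.
Qed.

Lemma vtx_total_v i : e (ordS i) * total_v = e (ordS i) * Gi (fwd i).
Proof.
rewrite mulr_sumr (bigD1 i) //= mulrA eM eqxx big1 ?addr0 // => j ne.
by rewrite mulrA eM (inj_eq (@ordS_inj _)) eq_sym (negPf ne) mul0r.
Qed.

Lemma sum_e_ordS : \sum_i e (ordS i) = 1.
Proof. by rewrite -[RHS]sum_e [RHS](reindex_inj (@ordS_inj n.+1)). Qed.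

Lemma total_vU : total_v * (1 + total_x * total_y) = 1.
Proof.
rewrite mulr_suml -[RHS]sum_e_ordS; apply: eq_bigr => i _.
by rewrite vtx_Gi_comm -[LHS]mulrA vtx_U [LHS]mulrA -vtx_Gi_comm -[LHS]mulrA Gi_G mulr1.
Qed.
Lemma total_Uv : (1 + total_x * total_y) * total_v = 1.
Proof.
rewrite -[RHS]sum_e_ordS -[LHS]mul1r -[X in X * _ = _]sum_e_ordS mulr_suml.
apply: eq_bigr => i _; rewrite [LHS]mulrA vtx_U vtx_G_comm -[LHS]mulrA vtx_total_v.
by rewrite [LHS]mulrA -vtx_G_comm -[LHS]mulrA G_Gi mulr1.
Qed.

(** The arrows and the inverses [wi] are recovered from the corners of x, y and v. *)
Lemma total_gen (P : A -> Prop) :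
  (forall a b, P a -> P b -> P (a + b)) -> (forall a b, P a -> P b -> P (a * b)) ->
  (forall c a, P a -> P (c *: a)) -> P total_x -> P total_y -> P total_v ->
  (forall i, P (e i)) -> forall a, P a.
Proof.
move=> PD PM PZ Px Py Pv Pe.
have P0 : P 0 by rewrite -(scale0r (e ord0)); apply: PZ.
have P1 : P 1 by rewrite -sum_e; apply: big_ind.
have PN a : P a -> P (- a) by rewrite -scaleN1r; apply: PZ.
have PX i : P (fwd_elt i) by rewrite -total_x_vtx; apply: PM.
have PY i : P (bwd_elt i) by rewrite -vtx_total_y; apply: PM.
have PGf i : P (G (fwd i)) by rewrite G_fwd; apply: PD => //; apply: PM.
have PGib i : P (Gi (bwd i)) by rewrite Gi_bwd; apply: PD => //; apply: PM.
have split_e i a : a = e i * a + (1 - e i) * a by rewrite -mulrDl addrC subrK mul1r.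
(* An element acting as the identity away from vertex [i] is [e i * a + (1 - e i)], so only its
   corner at [i] has to be reached. *)
have corner i a : (forall j, j != i -> e j * a = e j) -> P (e i * a) -> P a.
  move=> ea Pa; rewrite [a](split_e i); apply: (PD) => //.
  rewrite -sum_e (bigD1 i) //= addrAC subrr add0r mulr_suml (eq_bigr e) //.
  by apply: big_ind.
have PGif i : P (Gi (fwd i)).
  apply: (corner (ordS i)); first by move=> j ne; apply: vtx_Gi_neq; rewrite target_fwd.
  by rewrite -vtx_total_v; apply: PM.
have PGb i : P (G (bwd i)).
  apply: (corner i); first by move=> j ne; apply: vtx_G_neq; rewrite target_bwd.
  by rewrite -[i]ord_predK -vtx_Gi_rel -vtx_total_v; apply: PM.
apply: gen_arrows => // a; have [i [->|->]] := fwd_or_bwd a.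
- exact: PX.
- have := PY i; rewrite /bwd_elt; case E: (o i) => // /PN; rewrite opprK => PwY.
  (* This undoes the substitution for a reversed arrow, for which [w (bwd i)] is the factor
     [G (bwd i)] already reached. *)
  have -> : al (bwd i) = w (bwd i) * (wi (bwd i) * al (bwd i)) by rewrite mulrA wVr mul1r.
  apply: PM => //; have := PGb i; by rewrite /G /bwd E.
- by have := PGf i; have := PGif i; rewrite /G /Gi /fwd; case: (o i).
- by have := PGb i; have := PGib i; rewrite /G /Gi /bwd; case: (o i).
Qed.
End Relations.

(** * Generators and representations of the multiplicative preprojective algebra *)

Lemma free_alg_ind (k : fieldType) (X : choiceType) (P : free_alg k X -> Prop) :
  (forall f g, P f -> P g -> P (f + g)) -> (forall f g, P f -> P g -> P (f * g)) ->
  (forall c, P c%:A) -> (forall t, P (free_gen k t)) -> forall f, P f.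
Proof.
move=> PD PM PC PX f; rewrite [f]monalgE.
apply: big_ind => // [|m _]; first by rewrite -(scale0r 1).
rewrite malg_scaleU -mulr_algl; apply: (PM) => //.
case: m => s; elim: s => [|t s IHs].
  have -> : FMonom [::] = mone :> {fmonom X} by rewrite -fmoneE.
  by rewrite -[<< _ >>]scale1r; exact: PC.
have -> : << FMonom (t :: s) >> = free_gen k t * << FMonom s >> :> free_alg k X.
  rewrite free_genE [RHS]malgM_def fgmulUU mul1r; congr << _ >>.
  by rewrite [RHS]fmmulE fmuE.
exact: PM.
Qed.

Lemma path_alg_ind (k : fieldType) (Q : quiver) (P : path_alg k Q -> Prop) :
  (forall f g, P f -> P g -> P (f + g)) -> (forall c f, P f -> P (c *: f)) ->
  (forall p, P (path_elt k p)) -> forall f, P f.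
Proof.
move=> PD PZ Pp f; rewrite [f]path_alg_sum; apply: big_ind => // [|p _].
  by rewrite -(scale0r (path_elt k (trivial_path ord0))); exact: PZ.
exact: PZ.
Qed.

Lemma path_elt_cons (k : fieldType) (Q : quiver) (a : arrow Q) (p q : qpath Q) :
  val p = (target a, a :: (val q).2) -> path_target q = source a ->
  path_elt k p = path_arrow k Q a * path_elt k q.
Proof.
move=> ep eq; have E : path_comp (arrow_path a) q = Some p by apply/path_compE.
by rewrite path_elt_mul E.
Qed.

Lemma path_alg_gen (k : fieldType) (Q : quiver) (P : path_alg k Q -> Prop) :
  (forall f g, P f -> P g -> P (f + g)) -> (forall f g, P f -> P g -> P (f * g)) ->
  (forall c f, P f -> P (c *: f)) -> (forall i, P (path_vtx k Q i)) ->
  (forall a, P (path_arrow k Q a)) -> forall f, P f.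
Proof.
move=> PD PM PZ Pv Pa; apply: path_alg_ind => // -[[i s] wf].
elim: s i wf => [|a s IHs] i wf.
  have -> : exist _ (i, [::]) wf = trivial_path i :> qpath Q by exact: val_inj.
  exact: Pv.
have [/eqP ea wf'] := andP wf.
rewrite (@path_elt_cons k Q a _ (exist _ (source a, s) wf')) //; first exact: PM.
by rewrite /= ea.
Qed.

Section PathLift.
Variables (k : fieldType) (Q : quiver) (D : algType k).
Variables (eps : vertex Q -> D) (phi : arrow Q -> D).
Hypothesis epsM : forall i j, eps i * eps j = if i == j then eps i else 0.
Hypothesis sum_eps : \sum_i eps i = 1.
Hypothesis phi_l : forall a, eps (target a) * phi a = phi a.
Hypothesis phi_r : forall a, phi a * eps (source a) = phi a.

(** The leading idempotent gives a trivial path, whose product is empty, its value [eps i]. *)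
Definition path_val (p : qpath Q) : D :=
  eps (path_target p) * \prod_(a <- (val p).2) phi a.

Lemma path_val_source p : path_val p * eps (path_source p) = path_val p.
Proof.
case: p => [[i s] wf]; rewrite /path_val /path_source /path_target /=.
elim: s i wf => [|a s IHs] i /=; first by rewrite big_nil mulr1 epsM eqxx.
case/andP=> /eqP<- wf; rewrite !big_cons mulrA phi_l.
have E : phi a * \prod_(b <- s) phi b = phi a * (eps (source a) * \prod_(b <- s) phi b).
  by rewrite mulrA phi_r.
by rewrite E -[LHS]mulrA IHs.
Qed.

Lemma path_val_mul p q : path_val p * path_val q =
  if path_comp p q is Some r then path_val r else 0.
Proof.
have [e|/eqP ne] := eqVneq (path_source p) (path_target q); last first.
  rewrite path_comp_none // -path_val_source {2}/path_val mulrA -(mulrA (path_val p)).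
  by rewrite epsM; case: eqP => // _; rewrite mulr0 mul0r.
have [r Er] := path_comp_some e; rewrite Er.
rewrite -path_val_source {2}/path_val e mulrA -(mulrA (path_val p)) epsM eqxx.
rewrite -e path_val_source /path_val -mulrA -big_cat.
by rewrite (path_comp_target Er); have [_ ->] := (path_compE _ _ _).1 Er.
Qed.

Definition path_lift : path_alg k Q -> D := lin_ext path_val.
HB.instance Definition _ := GRing.Linear.on path_lift.
Fact path_lift_is_monoid_morphism : monoid_morphism path_lift.
Proof.
split=> [|f g].
  rewrite -[1]/(path_one k Q) /path_one [LHS](linear_sum path_lift) -sum_eps.
  apply: eq_bigr => i _; rewrite [LHS]lin_ext_elt /path_val /= big_nil; exact: mulr1.
have LD f' g' : path_lift (f' + g') = path_lift f' + path_lift g' by exact: linearD.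
have LZ c f' : path_lift (c *: f') = c *: path_lift f' by exact: linearZZ.
elim/path_alg_ind: f => [f f' IHf IHf'|c f IHf|p].
- by rewrite mulrDl !LD IHf IHf' mulrDl.
- have -> : c *: f * g = c *: (f * g) by exact: esym (scalerAl c f g).
  apply: etrans (LZ c (f * g)) (etrans (congr1 ( *:%R c) IHf) _).
  exact: etrans (scalerAl c _ _) (congr1 (fun u => u * path_lift g) (esym (LZ c f))).
elim/path_alg_ind: g => [g g' IHg IHg'|c g IHg|q].
- by rewrite mulrDr !LD IHg IHg' mulrDr.
- have -> : path_elt k p * (c *: g) = c *: (path_elt k p * g).
    exact: esym (scalerAr c (path_elt k p) g).
  apply: etrans (LZ c (path_elt k p * g)) (etrans (congr1 ( *:%R c) IHg) _).
  exact: etrans (scalerAr c _ _) (congr1 ( *%R (path_lift (path_elt k p))) (esym (LZ c g))).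
rewrite path_elt_mul /path_lift !lin_ext_elt path_val_mul.
by case: path_comp => [r|]; [exact: lin_ext_elt|exact: linear0].
Qed.
HB.instance Definition _ := GRing.isMonoidMorphism.Build (path_alg k Q) D
  path_lift path_lift_is_monoid_morphism.

Definition path_lift_lr : {lrmorphism path_alg k Q -> D} := path_lift.

Lemma path_lift_vtx i : path_lift (path_vtx k Q i) = eps i.
Proof. by rewrite [LHS]lin_ext_elt /path_val big_nil mulr1. Qed.
Lemma path_lift_arrow a : path_lift (path_arrow k Q a) = phi a.
Proof. by rewrite [LHS]lin_ext_elt /path_val big_seq1 phi_l. Qed.
End PathLift.

Section Mpa.
Variables (k : fieldType) (Q : quiver) (le : rel (arrow (double_quiver Q))).
Local Notation dQ := (double_quiver Q).
Local Notation L := (mpa k Q le).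
Local Notation pi := (quot_pi (@mpa_proper k Q le)).

Definition mpa_arrow (a : arrow dQ) : L := mpa_in le (path_arrow k dQ a).
Definition mpa_inv (a : arrow dQ) : L := pi (loc_inv (@LQ_proper k Q) a).
Definition mpa_factor (a : arrow dQ) : L := mpa_in le (one_add_aastar k a).
Local Notation e := (@mpa_vtx k Q le).

Lemma mpa_eM i j : e i * e j = if i == j then e i else 0.
Proof.
rewrite -[LHS]rmorphM /path_vtx path_elt_mul trivial_path_comp eq_sym.
by case: eqP => [->//|_]; exact: rmorph0.
Qed.
Lemma mpa_sum_e : \sum_i e i = 1.
Proof. by rewrite -[RHS](rmorph1 (mpa_in le)) -[LHS]raddf_sum. Qed.
Lemma mpa_arrow_l (a : arrow dQ) : e (target a) * mpa_arrow a = mpa_arrow a.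
Proof.
rewrite -[LHS]rmorphM /path_vtx path_elt_mul trivial_path_comp eqxx.
by [].
Qed.
Lemma mpa_arrow_r (a : arrow dQ) : mpa_arrow a * e (source a) = mpa_arrow a.
Proof.
rewrite -[LHS]rmorphM /path_vtx path_elt_mul path_comp_trivial eqxx.
by [].
Qed.
Lemma mpa_factorE (a : arrow dQ) : mpa_factor a = 1 + mpa_arrow a * mpa_arrow (star a).
Proof. by rewrite [LHS]rmorphD rmorph1 rmorphM. Qed.
Lemma mpa_invV (a : arrow dQ) : mpa_inv a * mpa_factor a = 1.
Proof. by rewrite -[LHS]rmorphM loc_mulVr rmorph1. Qed.
Lemma mpa_invVr (a : arrow dQ) : mpa_factor a * mpa_inv a = 1.
Proof. by have := congr1 pi (loc_mulrV (@LQ_proper k Q) a); rewrite rmorphM rmorph1. Qed.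

Lemma mpa_rho : \prod_(a <- sort le (enum (arrow dQ)))
  (match a with inl _ => mpa_factor a | inr _ => mpa_inv a end) = 1.
Proof.
transitivity (pi (@rho k Q le)).
  by rewrite [RHS]rmorph_prod; apply: eq_bigr => -[a|a] _.
rewrite -(rmorph1 pi); apply/quot_pi_eq; exact: ideal_gen_sub.
Qed.

Lemma mpa_gen (P : L -> Prop) :
  (forall a b, P a -> P b -> P (a + b)) -> (forall a b, P a -> P b -> P (a * b)) ->
  (forall c a, P a -> P (c *: a)) -> (forall i, P (e i)) -> (forall a, P (mpa_arrow a)) ->
  (forall a, P (mpa_inv a)) -> forall a, P a.
Proof.
move=> PD PM PZ Pe Pa Pi a.
have Pin f : P (mpa_in le f).
  elim/path_alg_gen: f => [f g Pf Pg|f g Pf Pg|c f Pf|i|b].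
  - by rewrite rmorphD; exact: PD.
  - by rewrite rmorphM; exact: PM.
  - by rewrite linearZ; exact: PZ.
  - exact: Pe.
  - exact: Pa.
(* The algebra is two quotients away from the free algebra on elements of the path algebra and
   formal inverses, so the predicate is pulled back to that free algebra. *)
pose R f := P (pi (quot_pi (@LQ_proper k Q) f)).
suff allR f : R f.
  have [b <-] := @quot_piP _ _ _ (@mpa_proper k Q le) a.
  by have [c <-] := @quot_piP _ _ _ (@LQ_proper k Q) b; exact: allR.
apply: (free_alg_ind (P := R)) => {f a} [f g Pf Pg|f g Pf Pg|c|[f|a]]; rewrite /R.
- have -> : pi (quot_pi (@LQ_proper k Q) (f + g)) =
    pi (quot_pi (@LQ_proper k Q) f) + pi (quot_pi (@LQ_proper k Q) g).
    by rewrite !rmorphD.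
  exact: PD.
- have -> : pi (quot_pi (@LQ_proper k Q) (f * g)) =
    pi (quot_pi (@LQ_proper k Q) f) * pi (quot_pi (@LQ_proper k Q) g).
    by rewrite !rmorphM.
  exact: PM.
- have -> : pi (quot_pi (@LQ_proper k Q) c%:A) = c *: mpa_in le 1.
    by rewrite !linearZ !rmorph1.
  exact: PZ.
- exact: Pin.
- exact: Pi.
Qed.
End Mpa.

Section MpaLift.
Variables (k : fieldType) (Q : quiver) (le : rel (arrow (double_quiver Q))).
Local Notation dQ := (double_quiver Q).
Variables (D : algType k) (f : {lrmorphism path_alg k dQ -> D}) (t : arrow dQ -> D).
Hypothesis tV : forall a, t a * f (one_add_aastar k a) = 1 /\ f (one_add_aastar k a) * t a = 1.
Hypothesis f_rho : \prod_(a <- sort le (enum (arrow dQ)))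
  (match a with inl _ => f (one_add_aastar k a) | inr _ => t a end) = 1.

Definition LQ_lift : LQ k Q -> D := loc_lift tV.
HB.instance Definition _ := GRing.LRMorphism.on LQ_lift.

Lemma LQ_lift_rho x : rho_rel le x -> LQ_lift x = 0.
Proof.
move=> ->; rewrite rmorphB rmorph1 rmorph_prod -[X in _ - X]f_rho; apply/eqP.
rewrite subr_eq0; apply/eqP; apply: eq_bigr => -[a|a] _; first exact: loc_liftE.
exact: loc_liftV.
Qed.

Definition mpa_lift : mpa k Q le -> D := quot_lift LQ_lift_rho.
HB.instance Definition _ := GRing.LRMorphism.on mpa_lift.
Lemma mpa_lift_in x : mpa_lift (mpa_in le x) = f x.
Proof. by rewrite [LHS]quot_liftE [LHS]loc_liftE. Qed.
Lemma mpa_lift_inv a : mpa_lift (mpa_inv k le a) = t a.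
Proof. by rewrite [LHS]quot_liftE [LHS]loc_liftV. Qed.
End MpaLift.

(** * The model representation by weighted shifts around the cycle *)

Section Model.
Variables (k : fieldType) (n : nat) (o : 'I_n.+1 -> bool).
Variable le : rel (arrow (double_quiver (Atilde n o))).
Local Notation dQ := (double_quiver (Atilde n o)).
Variables (F : comAlgType k) (X Y u' : F).
Hypothesis uV : u' * (1 + X * Y) = 1.
Local Notation u := (1 + X * Y).
Local Notation M := (kmx F n).

Definition kdiag (d : 'I_n.+1 -> F) : M := diag_mx (\row_i d i).
Lemma kdiagM d d' : kdiag d * kdiag d' = kdiag (fun i => d i * d' i).
Proof.
apply/matrixP => i j; rewrite [LHS](_ : _ = (diag_mx (\row_i d i) *m kdiag d') i j) //.
by rewrite mul_diag_mx !mxE mulrnAr.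
Qed.
Lemma kdiag1 : kdiag (fun=> 1) = 1.
Proof. by apply/matrixP => i j; rewrite [RHS](_ : _ = 1%:M i j) // !mxE. Qed.
Lemma kdiag_ext d d' : d =1 d' -> kdiag d = kdiag d'.
Proof. by move=> dd'; apply/matrixP => i j; rewrite !mxE dd'. Qed.
Lemma kdiag_prod (I : Type) (l : seq I) (d : I -> 'I_n.+1 -> F) :
  \prod_(a <- l) kdiag (d a) = kdiag (fun i => \prod_(a <- l) d a i).
Proof.
elim: l => [|a l IHl].
  by rewrite big_nil -kdiag1; apply: kdiag_ext => i; rewrite big_nil.
by rewrite big_cons IHl kdiagM; apply: kdiag_ext => i; rewrite big_cons.
Qed.

(* When the i-th arrow is reversed, this is the value for which
   bwd_elt = - (1 + y x)^-1 y acts as Y. *)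
Definition coef (a : arrow dQ) : F := match a with
  | inl i => if o i then X else - (u' * Y)
  | inr i => if o i then Y else X end.
Definition meps (i : 'I_n.+1) : M := delta_mx i i.
Definition mphi (a : arrow dQ) : M := coef a *: (delta_mx (target a) (source a) : 'M[F]_n.+1).

Lemma kmxM (a b : M) : a * b = (a : 'M[F]_n.+1) *m b. Proof. by []. Qed.

Lemma mepsM i j : meps i * meps j = if i == j then meps i else 0.
Proof. by rewrite kmxM mul_delta_mx_cond /meps; case: eqP => [->|]. Qed.
Lemma sum_meps : \sum_i meps i = 1.
Proof.
have E : \sum_i delta_mx i i = 1%:M :> 'M[F]_n.+1; last exact: E.
apply/matrixP => i j; rewrite summxE !mxE (bigD1 i) //= big1 => [|l ne]; last first.
  by rewrite mxE eq_sym (negPf ne).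
by rewrite mxE eqxx addr0 /= eq_sym; case: eqP.
Qed.
Lemma mphi_l (a : arrow dQ) : meps (target a) * mphi a = mphi a.
Proof. by rewrite kmxM /mphi -scalemxAr mul_delta_mx. Qed.
Lemma mphi_r (a : arrow dQ) : mphi a * meps (source a) = mphi a.
Proof. by rewrite kmxM /mphi -scalemxAl mul_delta_mx. Qed.

(** The scalar by which [one_add_aastar] acts at the target of the arrow; [vtx_facV] is its
    inverse. *)
Definition vtx_fac (a : arrow dQ) : F := let i := match a with inl i => i | inr i => i end in
  if o i then u else u'.
Definition vtx_facV (a : arrow dQ) : F := let i := match a with inl i => i | inr i => i end in
  if o i then u' else u.
Lemma vtx_fac_facV a : vtx_fac a * vtx_facV a = 1.
Proof. by case: a => i; rewrite /vtx_fac /vtx_facV; case: (o i); rewrite // mulrC. Qed.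

(** For a reversed arrow this is 1 - u'XY = u', a restatement of [uV]. *)
Lemma coef_star a : 1 + coef a * coef (star a) = vtx_fac a.
Proof.
have E : 1 - u' * Y * X = u'.
  by rewrite -{1}uV mulrDr mulr1 -mulrA [Y * X]mulrC addrK.
case: a => i; rewrite /= /vtx_fac; case: (o i) => //.
- by rewrite mulNr E.
- by rewrite mulrC.
by rewrite mulrC mulNr E.
Qed.

Definition at_vtx (i : 'I_n.+1) (s : F) : M := kdiag (fun j => if j == i then s else 1).
Lemma at_vtxM i s s' : at_vtx i s * at_vtx i s' = at_vtx i (s * s').
Proof. by rewrite kdiagM; apply: kdiag_ext => j; case: eqP; rewrite ?mulr1. Qed.
Lemma at_vtx1 i : at_vtx i 1 = 1.
Proof. by rewrite -kdiag1; apply: kdiag_ext => j; case: eqP. Qed.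

Local Notation f := (path_lift meps mphi).
Lemma mphi_fac (a : arrow dQ) : 1 + mphi a * mphi (star a) = at_vtx (target a) (vtx_fac a).
Proof.
have sr : source (star a) = target a by case: (a).
have tr : target (star a) = source a by case: (a).
rewrite kmxM /mphi sr tr -scalemxAl -scalemxAr mul_delta_mx scalerA -kdiag1.
apply/matrixP => i j; rewrite !mxE -coef_star.
have [->|ne] := eqVneq i j; last first.
  rewrite !mulr0n add0r; case: (eqVneq i _) => [ei|]; last by rewrite mulr0.
  by rewrite -ei eq_sym (negPf ne) mulr0.
by rewrite !mulr1n; case: eqP => _; rewrite ?mulr1 ?mulr0 ?addr0.
Qed.

(** In the commutative ring F the product may be reordered. For either orientation the two arrows
    over [i] contribute u at [ordS i] and u' at [i], so each vertex receives one u and one u'. *)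
Lemma vtx_fac_rho j : \prod_(a <- sort le (enum (arrow dQ)))
  (if j == target a then match a with inl _ => vtx_fac a | inr _ => vtx_facV a end
   else 1) = 1.
Proof.
rewrite (perm_big (enum (arrow dQ))) ?perm_sort //= big_enum /= big_sumType /=.
rewrite -big_split /= (eq_bigr (fun i => (if j == ordS i then u else 1) *
   (if j == i then u' else 1))) => [|i _]; last first.
  by rewrite /vtx_fac /vtx_facV; case: (o i); rewrite // mulrC.
rewrite big_split /= (bigD1 (ord_pred j)) //= ord_predK eqxx big1 => [|i ne]; last first.
  by rewrite -(can2_eq (@ord_predK _) (@ordSK _)) eq_sym (negPf ne).
rewrite (bigD1 j) //= eqxx big1 => [|i ne]; last by rewrite eq_sym (negPf ne).
by rewrite !mulr1 mulrC.
Qed.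

Definition model_path : {lrmorphism path_alg k dQ -> M} :=
  @path_lift_lr k dQ M meps mphi mepsM sum_meps mphi_l mphi_r.

Lemma model_fac (a : arrow dQ) :
  model_path (one_add_aastar k a) = at_vtx (target a) (vtx_fac a).
Proof.
rewrite rmorphD rmorph1 rmorphM -mphi_fac; congr (1 + _ * _); exact: path_lift_arrow mphi_l _.
Qed.

Definition model_inv (a : arrow dQ) : M := at_vtx (target a) (vtx_facV a).

Lemma model_V a : model_inv a * model_path (one_add_aastar k a) = 1 /\
  model_path (one_add_aastar k a) * model_inv a = 1.
Proof.
by rewrite model_fac !at_vtxM vtx_fac_facV mulrC vtx_fac_facV at_vtx1.
Qed.

Lemma model_rho : \prod_(a <- sort le (enum (arrow dQ)))
  (match a with inl _ => model_path (one_add_aastar k a) | inr _ => model_inv a end) = 1.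
Proof.
rewrite (eq_bigr (fun a : arrow dQ => at_vtx (target a)
   (match a with inl _ => vtx_fac a | inr _ => vtx_facV a end))) => [|[a|a] _]; last 2 first.
- exact: model_fac.
- by [].
by rewrite kdiag_prod -kdiag1; apply: kdiag_ext => j; exact: vtx_fac_rho.
Qed.

Definition model_lift : {lrmorphism mpa k (Atilde n o) le -> M} := mpa_lift model_V model_rho.

Lemma model_lift_vtx i : model_lift (mpa_vtx k le i) = delta_mx i i.
Proof. by rewrite [LHS]mpa_lift_in [LHS]path_lift_vtx. Qed.

Definition model_rep : rep (@mpa_vtx k _ le) F := rep_of model_lift_vtx.
End Model.

Section ModelGenerators.
Variables (k : fieldType) (n : nat) (o : 'I_n.+1 -> bool).
Variable le : rel (arrow (double_quiver (Atilde n o))).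
Local Notation dQ := (double_quiver (Atilde n o)).
Variables (F : comAlgType k) (X Y u' : F).
Hypothesis uV : u' * (1 + X * Y) = 1.
Local Notation r := (model_rep le uV).
Local Notation al := (@mpa_arrow k _ le).
Local Notation wi := (@mpa_inv k _ le).

Lemma model_arrow a : r (al a) = mphi X Y u' a.
Proof.
rewrite [LHS]mpa_lift_in; exact: (path_lift_arrow (@mphi_l k n o F X Y u')).
Qed.

Lemma model_inv_arrow a : r (wi a) = model_inv X Y u' a.
Proof. by rewrite [LHS]mpa_lift_inv. Qed.

Lemma model_fwd_elt i : r (fwd_elt al i) = X *: delta_mx (ordS i) i.
Proof.
rewrite model_arrow /mphi target_fwd source_fwd; congr (_ *: _).
by rewrite /fwd; case E: (o i); rewrite /= E.
Qed.

Lemma model_bwd_elt i : r (bwd_elt al wi i) = Y *: delta_mx i (ordS i).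
Proof.
rewrite /bwd_elt; case E: (o i).
  rewrite model_arrow /mphi target_bwd source_bwd; congr (_ *: _).
  by rewrite /bwd E /= E.
rewrite -scaleN1r repZ repM model_arrow model_inv_arrow /mphi /model_inv.
rewrite target_bwd source_bwd /at_vtx /kdiag.
apply/matrixP => a b; rewrite mxE mul_diag_mx !mxE /bwd E /= /vtx_facV E.
rewrite scaleN1r; case: eqP => _; last by rewrite /= !mulr0.
(* The inverse acts by u at [i] and the reversed arrow has coefficient -u'Y, so the entry is
   -u(-u'Y) = Y. *)
by rewrite mulN1r mulNr mulrN opprK !mulrA [_ * u']mulrC uV mul1r.
Qed.

Lemma model_total_x i j : r (total_x al) i j = if i == ordS j then X else 0.
Proof.
rewrite rep_sum summxE (bigD1 j) // big1 => [|l ne].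
  by rewrite [LHS]addr0 model_fwd_elt !mxE eqxx andbT; case: eqP; rewrite ?mulr1 ?mulr0.
by rewrite model_fwd_elt !mxE [j == l]eq_sym (negPf ne) andbF mulr0.
Qed.

Lemma model_total_y i j : r (total_y al wi) i j = if j == ordS i then Y else 0.
Proof.
rewrite rep_sum summxE (bigD1 i) // big1 => [|l ne].
  by rewrite [LHS]addr0 model_bwd_elt !mxE eqxx; case: eqP; rewrite ?mulr1 ?mulr0.
by rewrite model_bwd_elt !mxE [i == l]eq_sym (negPf ne) mulr0.
Qed.
End ModelGenerators.

(** * The field k(X, Y) as the base of the model *)

Section FractionField.
Variable k : fieldType.
Local Notation kXY := {poly {poly k}}.
Definition frac_phi : k -> {fraction kXY} := @tofrac kXY \o polyC \o polyC.
HB.instance Definition _ := GRing.RMorphism.on frac_phi.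
Definition frac_alg := comalg_via frac_phi.
HB.instance Definition _ := GRing.ComAlgebra.on frac_alg.
Definition frac_iota : kXY -> frac_alg := @tofrac kXY.
HB.instance Definition _ := GRing.RMorphism.copy frac_iota (@tofrac kXY).
Lemma frac_iota_inj : injective frac_iota.
Proof. by move=> a b /eqP; rewrite /frac_iota tofrac_eq => /eqP. Qed.
Lemma frac_iotaC c : frac_iota c%:P%:P = c%:A.
Proof. exact: esym (via_algE _ _). Qed.
Definition frac_uinv : frac_alg := (tofrac (1 + 'X * 'X%:P) : {fraction kXY})^-1.
Lemma frac_uV : frac_uinv * (1 + frac_iota 'X * frac_iota 'X%:P) = 1.
Proof.
rewrite -rmorphM -[1 in X in _ * X](rmorph1 frac_iota) -rmorphD.
apply: (mulVf (x := tofrac (1 + 'X * 'X%:P) : {fraction kXY})).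
(* In the outer variable, 1 + XY has constant coefficient 1. *)
rewrite tofrac_eq0; apply/eqP => /(congr1 (fun p : kXY => p`_0)) /eqP.
by rewrite coefD coef1 coefXM coef0 addr0 oner_eq0.
Qed.
End FractionField.

Theorem proposition6p19 (k : fieldType) (n : nat) (hn : (1 <= n)%N)
    (o : 'I_n.+1 -> bool) (le : rel (arrow (double_quiver (Atilde n o))))
    (le_order : [/\ reflexive le, antisymmetric le, transitive le & total le]) :
  exists evZ : {lrmorphism alg_center (mpa k (Atilde n o) le) ->
                           mqv_ring k (Atilde n o) le},
    (forall z : alg_center (mpa k (Atilde n o) le),
       mpa_ev k (Atilde n o) le (sval z) = (sval (evZ z))%:M) /\
    bijective evZ.
Proof.
have eM := @mpa_eM k _ le; have sum_e := @mpa_sum_e k _ le.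
have al_l := @mpa_arrow_l k _ le; have al_r := @mpa_arrow_r k _ le.
have wE := @mpa_factorE k _ le; have wV := @mpa_invV k _ le; have wVr := @mpa_invVr k _ le.
have l_uniq : uniq (sort le (enum (arrow (double_quiver (Atilde n o))))).
  by rewrite sort_uniq enum_uniq.
have l_all a : a \in sort le (enum (arrow (double_quiver (Atilde n o)))).
  by rewrite mem_sort mem_enum.
have rho1 := @mpa_rho k _ le; have gen := @mpa_gen k _ le.
(* The first arguments exhibit the algebra as a cyclic algebra on [total_x], [total_y] and
   [total_v]; the last ones supply the model over k(X, Y). The goal left over identifies [univ_rep]
   with [rep_ev], which holds by definition. *)
apply: (ev_center_iso eM sum_e (total_xe eM al_l al_r) (total_ye eM al_l al_r wE wV wVr)
  (total_xyC eM al_l al_r wE wV wVr l_uniq l_all rho1)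
  (total_vU eM sum_e al_l al_r wE wV wVr) (total_Uv eM sum_e al_l al_r wE wV wVr)
  (fun P => @total_gen k n o _ _ _ _ _ eM sum_e al_l al_r wE wV wVr _ l_uniq l_all rho1 gen P)
  (ev := univ_rep _) _ (@frac_iota_inj k) (@frac_iotaC k)
  (model_total_x le (frac_uV k)) (model_total_y le (frac_uV k))).
by [].
Qed.
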